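(* Let $(M,H)$ be an $n$-dimensional Carnot manifold with weight sequence $(w_1,\ldots,w_n)$, let $(X_1,\ldots,X_n)$ be an $H$-frame near a point $a\in M$, and let $x=(x_1,\ldots,x_n)$ be local coordinates near $a$. Then the $\psi$-privileged coordinates (those given by the change of coordinates $x\mapsto\psi_a(x)$) are the unique privileged coordinates at $a$ adapted to the $H$-frame $(X_1,\ldots,X_n)$ that are given by a change of coordinates of the form $y=\hat\psi(Tx)$, where $T$ is an affine map such that $T(a)=0$ and $\hat\psi$ is a polynomial diffeomorphism whose components are of the form $$\hat\psi_k(x)=x_k+\sum_{\substack{\langle\alpha\rangle<w_k\\|\alpha|\ge2}}a_{k\alpha}x^\alpha,\qquad a_{k\alpha}\in\mathbb{R},\quad k=1,\ldots,n.$$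
   Context: A Carnot manifold of step $r$ is a pair $(M,H)$, where $M$ is a smooth manifold and $H=(H_1,\ldots,H_r)$ is a filtration of subbundles $H_1\subset\cdots\subset H_r=TM$ such that Lie brackets of sections of $H_w$ and $H_{w'}$ are sections of $H_{w+w'}$ whenever $w+w'\le r$. With $n=\dim M$, its weight sequence is $w_j=\min\{w\in\{1,\ldots,r\}:\ j\le\operatorname{rk}H_w\}$, $j=1,\ldots,n$. An $H$-frame over an open set is a tangent frame $(X_1,\ldots,X_n)$ such that each $X_j$ is a section of $H_{w_j}$. For a finite sequence $I=(i_1,\ldots,i_k)$ in $\{1,\ldots,n\}$ set $X_I=X_{i_1}\cdots X_{i_k}$ and $\langle I\rangle=w_{i_1}+\cdots+w_{i_k}$. A smooth function $f$ near $a$ has order $\ge N$ at $a$ ($N$ a non-negative integer) if $X_If(a)=0$ whenever $\langle I\rangle<N$; it has order $N$ if moreover $X_If(a)\neq0$ for some $I$ with $\langle I\rangle=N$. Local coordinates centered at $a$ are linearly adapted at $a$ to $(X_1,\ldots,X_n)$ if, in these coordinates, $X_j(0)=\partial_j$ for $j=1,\ldots,n$. They are privileged coordinates at $a$ adapted to $(X_1,\ldots,X_n)$ if they are linearly adapted and, for every $k$, the coordinate function $x_k$ has order $w_k$ at $a$. For $\alpha\in\mathbb{N}_0^n$: $|\alpha|=\alpha_1+\cdots+\alpha_n$ and $\langle\alpha\rangle=w_1\alpha_1+\cdots+w_n\alpha_n$. The point $a$ is identified with its coordinate vector in the given local coordinates. Definition of $\psi_a$. Write $X_j=\sum_k b_{jk}(x)\partial_{x_k}$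 and $B(x)=(b_{jk}(x))$. The map $T_a(x)=(B(a)^t)^{-1}(x-a)$ is the unique affine change of coordinates giving coordinates centered at $a$ that are linearly adapted to $(X_1,\ldots,X_n)$. Let $\hat\psi_a$ be the unique change of coordinates which transforms the linearly adapted coordinates given by $T_a$ into privileged coordinates at $a$ adapted to $(X_1,\ldots,X_n)$ and has components of the form $x_k+\sum_{\langle\alpha\rangle<w_k,\,|\alpha|\ge2}a_{k\alpha}x^\alpha$ (such a map exists and is unique). Then $\psi_a=\hat\psi_a\circ T_a$. *)

(* Defs.v *)
From HB Require Import structures.
From mathcomp Require Import all_boot all_order all_algebra.
From mathcomp Require Import all_classical all_reals all_analysis.
Set Implicit Arguments.
Unset Strict Implicit.
Unset Printing Implicit Defensive.
Import Order.TTheory GRing.Theory Num.Theory.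
Import numFieldNormedType.Exports.
Local Open Scope classical_set_scope.
Local Open Scope ring_scope.

(* The coordinate space R^n is 'rV[R]_n: points are row vectors, and the
   indices 1..n of the coordinates are the elements 0..n-1 of 'I_n. *)

Section Euclidean.
Context {R : realType} {n : nat}.
Implicit Types (f : 'rV[R]_n -> R) (g : 'rV[R]_n -> 'rV[R]_n) (y : 'rV[R]_n).

Definition pderiv (i : 'I_n) f : 'rV[R]_n -> R := fun y => 'D_(delta_mx 0 i) f y.

Definition pderivs (s : seq 'I_n) f : 'rV[R]_n -> R := foldr pderiv f s.

(* f is C^oo on a neighbourhood of y. *)
Definition smooth_at f y : Prop :=
  \forall z \near y, forall s : seq 'I_n, differentiable (pderivs s f) z.

Definition smooth_map_at g y : Prop :=
  forall k : 'I_n, smooth_at (fun z => g z 0 k) y.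

Definition diffeomorphism g : Prop :=
  exists h : 'rV[R]_n -> 'rV[R]_n,
    [/\ cancel g h, cancel h g,
        forall y, smooth_map_at g y & forall y, smooth_map_at h y].

Definition affine_map g : Prop :=
  exists (A : 'M[R]_n) (b : 'rV[R]_n), forall y, g y = y *m A + b.

End Euclidean.

(* [cmap] is meaningful on [cdom] only, and [cinv] on the image of [cdom]. *)
Record chart (R : realType) (M : topologicalType) (n : nat) := Chart {
  cdom : set M;
  cmap : M -> 'rV[R]_n;
  cinv : 'rV[R]_n -> M }.

Section Charts.
Context {R : realType} {M : topologicalType} {n : nat}.
Implicit Types c d : chart R M n.

Definition is_chart c : Prop :=
  [/\ open (cdom c),
      open (cmap c @` cdom c),
      forall p, cdom c p -> cinv c (cmap c p) = p,
      forall p, cdom c p -> {for p, continuous (cmap c)} &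
      forall p, cdom c p -> {for cmap c p, continuous (cinv c)}].

Definition compatible c d : Prop :=
  forall p, cdom c p -> cdom d p ->
    smooth_map_at (cmap d \o cinv c) (cmap c p) /\
    smooth_map_at (cmap c \o cinv d) (cmap d p).

(* The k-th coordinate function x_k. *)
Definition coord c (k : 'I_n) : M -> R := fun p => cmap c p 0 k.

End Charts.

(* The atlas is maximal, so that its elements are exactly the smooth local
   coordinate systems. *)
Record manifold (R : realType) (n : nat) := Manifold {
  carrier :> topologicalType;
  atlas : set (chart R carrier n);
  _ : hausdorff_space carrier;
  _ : @second_countable carrier;
  _ : forall c, atlas c -> is_chart c;
  _ : forall p, exists2 c, atlas c & cdom c p;
  _ : forall c d, atlas c -> atlas d -> compatible c d;
  _ : forall c, is_chart c -> (forall d, atlas d -> compatible c d) -> atlas c }.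

Section Tangent.
Context {R : realType} {n : nat} {M : manifold R n}.

Definition smooth_fun_at (f : M -> R) (p : M) : Prop :=
  forall c, atlas c -> cdom c p -> smooth_at (f \o cinv c) (cmap c p).

(* Tangent vectors at p are derivations of the functions that are smooth near
   p.  They are totalized by the value 0 on all other functions, so that the
   tangent space at p is a linear subspace of functional and equality of
   tangent vectors is equality of functions. *)
Definition functional : Type := (M -> R) -> R.

(* The vector \partial_k at p of the coordinate system c. *)
Definition coord_vector (c : chart R M n) (k : 'I_n) (p : M) : functional :=
  fun f => if `[< smooth_fun_at f p >]
           then pderiv k (f \o cinv c) (cmap c p) else 0.

Definition tangent_space (p : M) : set functional :=
  [set v | exists c, [/\ atlas c, cdom c p &
     exists u : 'rV[R]_n, v = \sum_k u 0 k *: coord_vector c k p]].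

(* A section of TM is a function X with X p in the tangent space at p; it acts
   on functions by (X f) p = X p f. *)
Definition field : Type := M -> functional.

Definition apply_field (X : field) (f : M -> R) : M -> R := fun p => X p f.

Definition vector_field (U : set M) (X : field) : Prop :=
  forall p, U p -> tangent_space p (X p) /\
    forall f, smooth_fun_at f p -> smooth_fun_at (apply_field X f) p.

Definition bracket (X Y : field) : field :=
  fun p f => if `[< smooth_fun_at f p >]
             then X p (apply_field Y f) - Y p (apply_field X f) else 0.

Definition basis_of (V : set functional) (d : nat) (v : 'I_d -> functional) :
    Prop :=
  (forall u : 'rV[R]_d, \sum_i u 0 i *: v i = 0 -> u = 0) /\
  V = [set \sum_i u 0 i *: v i | u in [set: 'rV[R]_d]].

(* V is a smooth subbundle of TM of rank d. *)
Definition subbundle (V : M -> set functional) (d : nat) : Prop :=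
  forall p, exists (U : set M) (Y : 'I_d -> field),
    [/\ open U, U p, forall i, vector_field U (Y i) &
        forall q, U q -> basis_of (V q) (fun i => Y i q)].

Definition section_of (V : M -> set functional) (U : set M) (X : field) : Prop :=
  vector_field U X /\ forall p, U p -> V p (X p).

End Tangent.

Arguments functional {R n} M.
Arguments field {R n} M.

Record carnot_manifold (R : realType) (n r : nat) := CarnotManifold {
  base :> manifold R n;
  filt : nat -> base -> set (functional base);
  rk : nat -> nat;
  _ : (0 < r)%N;
  _ : forall w, (1 <= w <= r)%N -> subbundle (filt w) (rk w);
  _ : forall w, (1 <= w < r)%N -> forall p, filt w p `<=` filt w.+1 p;
  _ : forall p, filt r p = tangent_space p;
  _ : forall w w', (1 <= w)%N -> (1 <= w')%N -> (w + w' <= r)%N ->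
        forall (U : set base) (X Y : field base), open U ->
        section_of (filt w) U X -> section_of (filt w') U Y ->
        section_of (filt (w + w')) U (bracket X Y) }.

Section Carnot.
Context {R : realType} {n r : nat} (M : carnot_manifold R n r).
Implicit Types (X : 'I_n -> field M) (a p : M) (x y : chart R M n).

(* w_j = min {w in {1..r} : j <= rk H_w}, where j in {1..n} is the successor of
   the element j of 'I_n; the set contains r since rk H_r = n. *)
Definition weight (j : 'I_n) : nat :=
  \big[minn/r]_(1 <= w < r.+1 | (j.+1 <= rk M w)%N) w.

Definition h_frame (U : set M) X : Prop :=
  [/\ open U,
      forall p, U p -> basis_of (tangent_space p) (fun j => X j p) &
      forall j, section_of (filt (weight j)) U (X j)].

(* X_I f for I = (i_1,...,i_k). *)
Definition apply_word X (I : seq 'I_n) (f : M -> R) : M -> R :=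
  foldr (fun i => apply_field (X i)) f I.

Definition word_weight (I : seq 'I_n) : nat := \sum_(i <- I) weight i.

Definition order_ge X (f : M -> R) (N : nat) a : Prop :=
  forall I, (word_weight I < N)%N -> apply_word X I f a = 0.

Definition has_order X (f : M -> R) (N : nat) a : Prop :=
  order_ge X f N a /\
  exists2 I, word_weight I = N & apply_word X I f a != 0.

Definition linearly_adapted X a y : Prop :=
  cmap y a = 0 /\ forall j, X j a = coord_vector y j a.

Definition privileged X a y : Prop :=
  linearly_adapted X a y /\ forall k, has_order X (coord y k) (weight k) a.

(* The change of coordinates psi transforms the coordinates x into privileged
   coordinates at a adapted to X; psi \o x has to be a coordinate system on
   some neighbourhood of a only. *)
Definition gives_privileged X a x (psi : 'rV[R]_n -> 'rV[R]_n) : Prop :=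
  exists y, [/\ atlas y, cdom y a, cdom y `<=` cdom x,
    forall p, cdom y p -> cmap y p = psi (cmap x p) & privileged X a y].

(* The components of psi are x_k + \sum_alpha a_{k alpha} x^alpha, over the
   alpha such that <alpha> < w_k and |alpha| >= 2.  The weights being at least
   1, the entries of such an alpha are smaller than w_k. *)
Definition psi_hat_form (psi : 'rV[R]_n -> 'rV[R]_n) : Prop :=
  exists c : forall k : 'I_n, {ffun 'I_n -> 'I_(weight k)} -> R,
  forall (z : 'rV[R]_n) (k : 'I_n), psi z 0 k = z 0 k +
    \sum_(alpha : {ffun 'I_n -> 'I_(weight k)} |
            ((\sum_i weight i * alpha i < weight k) &&
             (2 <= \sum_i alpha i))%N)
      c k alpha * \prod_i z 0 i ^+ alpha i.

(* B(a) = (b_{jk}(a)), where X_j = \sum_k b_{jk} \partial_{x_k}, so that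
   b_{jk} = X_j x_k. *)
Definition frame_matrix X a x : 'M[R]_n := \matrix_(j, k) X j a (coord x k).

(* T_a(z) = (B(a)^t)^-1 (z - a), transposed since z is a row vector. *)
Definition T_map X a x (z : 'rV[R]_n) : 'rV[R]_n :=
  (z - cmap x a) *m invmx (frame_matrix X a x).

(* "The unique" map with the two properties, by choice; [get] returns a default
   value if there is no such map. *)
Definition psi_hat_map X a x : 'rV[R]_n -> 'rV[R]_n :=
  get [set psi | psi_hat_form psi /\
                 gives_privileged X a x (psi \o T_map X a x)].

Definition psi_map X a x : 'rV[R]_n -> 'rV[R]_n :=
  psi_hat_map X a x \o T_map X a x.

Definition affine_psi_hat_form a x (psi : 'rV[R]_n -> 'rV[R]_n) : Prop :=
  exists T psi_hat : 'rV[R]_n -> 'rV[R]_n,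
    [/\ affine_map T, T (cmap x a) = 0, psi_hat_form psi_hat,
        diffeomorphism psi_hat & psi = psi_hat \o T].

End Carnot.

(* Main.v *)
(** Words X_I in the frame only matter through their values at a.  Since
    [X_i, X_j] is a combination, with smooth coefficients, of the X_k with
    w_k <= w_i + w_j, exchanging two adjacent letters changes X_I f (a) by values
    of shorter words of no larger weight; hence f has order >= N at a as soon as
    the sorted words X^beta with <beta> < N kill f at a.  In linearly adapted
    coordinates y, the matrix of the X^beta (y^alpha) (a) is triangular for the
    length |alpha|, with nonzero diagonal, so exactly one choice of the
    coefficients a_{k alpha} makes y_k + sum_alpha a_{k alpha} y^alpha vanish
    under all X^beta with <beta> < w_k.  As the correction has no terms of degree
    at most one, linear adaptedness forces the affine part to be T_a. *)
From HB Require Import structures.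
From mathcomp Require Import all_boot all_order all_algebra.
From mathcomp Require Import all_classical all_reals all_analysis.
From mathcomp Require Import ring zify.
Require Import Defs.
Set Implicit Arguments.
Unset Strict Implicit.
Unset Printing Implicit Defensive.
Import Order.TTheory GRing.Theory Num.Theory.
Import numFieldNormedType.Exports.
Local Open Scope classical_set_scope.
Local Open Scope ring_scope.

(** * Smooth functions on R^n *)

(** The bracket condition is available only for [w + w' <= r], so words are rearranged only below
    weight [r]; this suffices because every weight is at most [r]. That a bracket involves only
    frame fields of low weight is a fact about one fibre: by linear algebra, the [X_j] with
    [w_j <= w] span [H_w]. The coefficients of a bracket are functions, not constants, and the
    letters on their left may differentiate them; this is why errors are controlled through
    subwords. The weights also make psi-hat invertible: [x^alpha] with [<alpha> < w_k] contains only
    variables of weight below [w_k], so the polynomial map has a global smooth inverse, and the new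
    coordinates form a chart. *)

Lemma near_openP (T : topologicalType) (z : T) (P : set T) :
  (\forall y \near z, P y) <-> exists V, [/\ open V, V z & V `<=` P].
Proof.
rewrite -[X in X <-> _]/(nbhs z P) nbhsE; split=> [[V [oV Vz] VP]|[V [oV Vz VP]]].
  by exists V.
by exists V.
Qed.

(** Locality is obtained by carrying the first-order expansion of [f] over to [g] and using
    uniqueness of the differential. *)
Lemma near_eq_differentiable (R : numFieldType) (V W : normedModType R)
    (f g : V -> W) (x : V) :
  (\forall z \near x, f z = g z) -> differentiable f x -> differentiable g x.
Proof.
move=> fg df; have gx : g x = f x by rewrite (nbhs_singleton fg).
have Dg : g \o shift x = cst (g x) + 'd f x +o_ 0 id.
  apply/eqaddoP => e e0.
  have /eqaddoP/(_ e e0) := diff_locally df.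
  have : \forall h \near 0, f (h + x) = g (h + x).
    by move: fg; rewrite (near_shift 0) subr0.
  apply: filterS2 => h /= fgh; rewrite gx.
  by rewrite ![(_ - _) _]/((_ \- _) _) /= -fgh.
have c := diff_continuous df.
by apply/diff_locallyP; rewrite (diff_unique c Dg).
Qed.

Section SmoothOn.
Context {R : realType} {n : nat}.
Implicit Types (V W : set 'rV[R]_n) (f g : 'rV[R]_n -> R)
  (phi : 'rV[R]_n -> 'rV[R]_n) (z : 'rV[R]_n).

Definition smooth_on V f :=
  forall z, V z -> forall s : seq 'I_n, differentiable (pderivs s f) z.

Lemma smooth_atP f z :
  smooth_at f z <-> exists V, [/\ open V, V z & smooth_on V f].
Proof.
split=> [/nbhs_interior|[V [oV Vz sV]]]; last first.
  by apply: filterS (open_nbhs_nbhs (conj oV Vz)) => y /sV.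
move=> /near_openP[V [oV Vz sV]]; exists V; split=> // y /sV.
exact: nbhs_singleton.
Qed.

Lemma pderivs_eq_on V f g s : open V -> {in V, f =1 g} ->
  {in V, pderivs s f =1 pderivs s g}.
Proof.
move=> oV fg; elim: s => //= i s IH z zV; apply: near_eq_derive.
have := open_nbhs_nbhs (conj oV (set_mem zV)).
by apply: filterS => y /mem_set; apply: IH.
Qed.

Lemma smooth_on_eq V f g : open V -> {in V, f =1 g} ->
  smooth_on V f -> smooth_on V g.
Proof.
move=> oV fg sf z Vz s; apply: near_eq_differentiable (sf z Vz s).
have := open_nbhs_nbhs (conj oV Vz).
by apply: filterS => y /mem_set; apply: pderivs_eq_on.
Qed.

Lemma smooth_on_pderiv V f i : smooth_on V f -> smooth_on V (pderiv i f).
Proof. by move=> sf z Vz s; have := sf z Vz (rcons s i); rewrite /pderivs foldr_rcons. Qed.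

Lemma smooth_on_differentiable V f z :
  smooth_on V f -> V z -> differentiable f z.
Proof. by move=> sf Vz; apply: (sf z Vz [::]). Qed.

(** Coinduction, which replaces formulas for iterated derivatives of products and composites.
    Stability under [pderiv] is asked up to equality on [V] only, since the rule for inverses, for
    instance, holds only where the function does not vanish. *)
Lemma smooth_on_coind V (A : set ('rV[R]_n -> R)) : open V ->
  (forall f, A f -> forall z, V z -> differentiable f z) ->
  (forall f i, A f -> exists2 g, A g & {in V, pderiv i f =1 g}) ->
  A `<=` smooth_on V.
Proof.
move=> oV dA pA f Af z Vz s; move: f Af; elim/last_ind: s => [|s i IH] f Af.
  exact: dA.
rewrite /pderivs foldr_rcons -/(pderivs s (pderiv i f)).
have [g Ag fg] := pA f i Af.
apply: near_eq_differentiable (IH g Ag).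
have := open_nbhs_nbhs (conj oV Vz).
apply: filterS => y /mem_set yV; apply: (pderivs_eq_on _ oV) yV => y' y'V.
by rewrite fg.
Qed.

Lemma pderiv_cst i c z : pderiv i (fun=> c) z = 0.
Proof. exact: derive_cst. Qed.

Lemma pderivD i f g z : differentiable f z -> differentiable g z ->
  pderiv i (f \+ g) z = pderiv i f z + pderiv i g z.
Proof. by move=> df dg; apply: deriveD; apply: diff_derivable. Qed.

Lemma pderivM i f g z : differentiable f z -> differentiable g z ->
  pderiv i (f \* g) z = f z * pderiv i g z + g z * pderiv i f z.
Proof. by move=> df dg; apply: deriveM; apply: diff_derivable. Qed.

Lemma row_diffE f z v : differentiable f z ->
  'd f z v = \sum_k v 0 k * pderiv k f z.
Proof.
move=> df; rewrite {1}(row_sum_delta v) linear_sum /=.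
by apply: eq_bigr => k _; rewrite linearZ /pderiv deriveE.
Qed.

Lemma row_differentiable phi z :
  (forall k, differentiable (fun y => phi y 0 k) z) -> differentiable phi z.
Proof.
move=> d; suff -> : phi = \sum_k (fun y => phi y 0 k *: delta_mx 0 k).
  by apply: differentiable_sum => k; apply: differentiableZl.
by apply/funext => y; rewrite fct_sumE -row_sum_delta.
Qed.

Lemma pderiv_comp i f phi z : differentiable f (phi z) ->
  (forall k, differentiable (fun y => phi y 0 k) z) ->
  pderiv i (f \o phi) z =
    \sum_k pderiv i (fun y => phi y 0 k) z * pderiv k f (phi z).
Proof.
move=> df dphi; have dp := row_differentiable dphi.
rewrite {1}/pderiv deriveE; last exact: differentiable_comp.
rewrite diff_comp //= row_diffE //; apply: eq_bigr => k _; congr (_ * _).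
rewrite -deriveE // derive_mx ?mxE //.
exact: diff_derivable.
Qed.

Lemma pderiv_coord i k z : pderiv i (fun y => y 0 k) z = (i == k)%:R.
Proof.
rewrite /pderiv deriveE; last exact: differentiable_coord.
pose f (y : 'rV[R]_n) := y 0 k : R.
have fl : linear f by move=> c u v; rewrite /f !mxE.
pose F : {linear 'rV[R]_n -> R} := HB.pack f (GRing.isLinear.Build _ _ _ _ _ fl).
rewrite -[X in 'd X _]/(F : _ -> _) diff_lin; last exact: coord_continuous.
by rewrite /= /f mxE eqxx eq_sym.
Qed.

(** The class to which coinduction is applied. It is stable under partial derivatives because the
    sum, product, inverse and chain rules stay within these operations. *)
Inductive smooth_closure V : ('rV[R]_n -> R) -> Prop :=
| closure_smooth f : smooth_on V f -> smooth_closure V f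
| closureD f g : smooth_closure V f -> smooth_closure V g ->
    smooth_closure V (f \+ g)
| closureM f g : smooth_closure V f -> smooth_closure V g ->
    smooth_closure V (f \* g)
| closureV f : smooth_closure V f -> (forall z, V z -> f z != 0) ->
    smooth_closure V (fun z => (f z)^-1)
| closure_comp W f phi : (forall z, V z -> W (phi z)) -> smooth_on W f ->
    (forall k, smooth_on V (fun z => phi z 0 k)) -> smooth_closure V (f \o phi).

Lemma smooth_on_cst V c : smooth_on V (fun=> c).
Proof.
move=> z _ s.
suff [c' ->] : exists c', pderivs s (fun=> c) = fun=> c'.
  exact: differentiable_cst.
elim: s => [|i s [c' /= ->]]; first by exists c.
by exists 0; apply/funext => y; rewrite pderiv_cst.
Qed.

Lemma smooth_closure_sum V I (r : seq I) (F : I -> 'rV[R]_n -> R) :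
  (forall i, smooth_closure V (F i)) ->
  smooth_closure V (fun z => \sum_(i <- r) F i z).
Proof.
move=> sF; elim: r => [|i r IH].
  under eq_fun do rewrite big_nil.
  exact/closure_smooth/smooth_on_cst.
under eq_fun do rewrite big_cons.
exact: closureD.
Qed.

Lemma smooth_closure_differentiable V f z :
  smooth_closure V f -> V z -> differentiable f z.
Proof.
move=> + Vz; elim=> {f}.
- by move=> f sf; apply: smooth_on_differentiable sf Vz.
- by move=> f g _ df _ dg; apply: differentiableD.
- by move=> f g _ df _ dg; apply: differentiableM.
- by move=> f _ df f0; apply: differentiableV => //; apply: f0.
- move=> W f phi VW sf sphi; apply: differentiable_comp.
    by apply: row_differentiable => k; apply: smooth_on_differentiable (sphi k) Vz.
  exact: smooth_on_differentiable sf (VW _ Vz).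
Qed.

Lemma smooth_closureP V f : open V -> smooth_closure V f -> smooth_on V f.
Proof.
move=> oV; move: f; apply: smooth_on_coind => //.
  by move=> f sf z; apply: smooth_closure_differentiable.
move=> f i; elim=> {f}.
- move=> f sf; exists (pderiv i f) => //.
  exact/closure_smooth/smooth_on_pderiv.
- move=> f g sf [f' sf' ff'] sg [g' sg' gg'].
  exists (f' \+ g'); first exact: closureD.
  move=> z zV; have Vz := set_mem zV.
  by rewrite pderivD ?ff' ?gg' //; apply: smooth_closure_differentiable Vz.
- move=> f g sf [f' sf' ff'] sg [g' sg' gg'].
  exists ((f \* g') \+ (g \* f')); first by apply: closureD; apply: closureM.
  move=> z zV; have Vz := set_mem zV.
  by rewrite pderivM ?ff' ?gg' //; apply: smooth_closure_differentiable Vz.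
- move=> f sf [f' sf' ff'] f0; have sV := closureV sf f0.
  exists (((fun=> - 1) \* f') \* ((fun z => (f z)^-1) \* (fun z => (f z)^-1))).
    by do !apply: closureM => //; apply/closure_smooth/smooth_on_cst.
  move=> z zV; have Vz := set_mem zV.
  rewrite {1}/pderiv deriveV ?f0 //; last first.
    exact/diff_derivable/(smooth_closure_differentiable sf).
  rewrite -/(pderiv i f z) ff' //= -[LHS]/(_ * _) expr2 invfM !mulNr mul1r.
  by rewrite [f' z * _]mulrC.
- move=> W f phi VW sf sphi.
  exists (fun z => \sum_k pderiv i (fun y => phi y 0 k) z * pderiv k f (phi z)).
    apply: smooth_closure_sum => k; apply: closureM.
      exact/closure_smooth/smooth_on_pderiv.
    by apply: closure_comp VW _ sphi; apply: smooth_on_pderiv.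
  move=> z zV; have Vz := set_mem zV; rewrite pderiv_comp //.
    exact: smooth_on_differentiable sf (VW _ Vz).
  by move=> k; apply: smooth_on_differentiable (sphi k) Vz.
Qed.

Lemma smooth_on_coord V k : smooth_on V (fun z => z 0 k).
Proof.
pose A := [set f : 'rV[R]_n -> R | (exists c, f = fun=> c) \/
  f = fun z => z 0 k].
suff : A `<=` smooth_on setT by move=> /(_ _ (or_intror erefl)) + z _; exact.
apply: smooth_on_coind; first exact: openT.
  move=> f [[c ->]|->] z _; first exact: differentiable_cst.
  exact: differentiable_coord.
move=> f i [[c ->]|->].
  by exists (fun=> 0) => [|z _]; [left; exists 0|rewrite pderiv_cst].
by exists (fun=> (i == k)%:R) => [|z _]; [left; exists (i == k)%:R|rewrite pderiv_coord].
Qed.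

End SmoothOn.

(** * Smoothness at a point and triangular diffeomorphisms *)

Section SmoothAt.
Context {R : realType} {n : nat}.
Implicit Types (f g : 'rV[R]_n -> R) (phi : 'rV[R]_n -> 'rV[R]_n)
  (z : 'rV[R]_n).

Lemma smooth_at_differentiable f z : smooth_at f z -> differentiable f z.
Proof. by move=> /nbhs_singleton/(_ [::]). Qed.

Lemma smooth_map_at_differentiable phi z :
  smooth_map_at phi z -> differentiable phi z.
Proof.
by move=> s; apply: row_differentiable => k; apply: smooth_at_differentiable (s k).
Qed.

Lemma smooth_map_at_continuous phi z :
  smooth_map_at phi z -> {for z, continuous phi}.
Proof. by move=> /smooth_map_at_differentiable/differentiable_continuous. Qed.

Lemma smooth_at_near f z : smooth_at f z -> \forall y \near z, smooth_at f y.
Proof. by move=> /nbhs_interior. Qed.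

Lemma smooth_at_eq f g z :
  (\forall y \near z, f y = g y) -> smooth_at f z -> smooth_at g z.
Proof.
move=> /near_openP[V [oV Vz fg]] /smooth_atP[W [oW Wz sf]].
apply/smooth_atP; exists (V `&` W); split=> //; first exact: openI.
apply: (@smooth_on_eq _ _ _ f); first exact: openI.
  by move=> y /set_mem[/fg].
by move=> y [_ /sf].
Qed.

Lemma smooth_at_cst c z : smooth_at (fun=> c) z.
Proof. by apply/smooth_atP; exists setT; split=> //; [exact: openT|exact: smooth_on_cst]. Qed.

Lemma smooth_at_coord k z : smooth_at (fun y => y 0 k) z.
Proof. by apply/smooth_atP; exists setT; split=> //; [exact: openT|exact: smooth_on_coord]. Qed.

Lemma smooth_atD f g z : smooth_at f z -> smooth_at g z -> smooth_at (f \+ g) z.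
Proof.
move=> /smooth_atP[V [oV Vz sf]] /smooth_atP[W [oW Wz sg]].
have oVW : open (V `&` W) by apply: openI.
apply/smooth_atP; exists (V `&` W); split=> //; apply: smooth_closureP => //.
by apply: closureD; apply: closure_smooth => y [/sf + /sg].
Qed.

Lemma smooth_atM f g z : smooth_at f z -> smooth_at g z -> smooth_at (f \* g) z.
Proof.
move=> /smooth_atP[V [oV Vz sf]] /smooth_atP[W [oW Wz sg]].
have oVW : open (V `&` W) by apply: openI.
apply/smooth_atP; exists (V `&` W); split=> //; apply: smooth_closureP => //.
by apply: closureM; apply: closure_smooth => y [/sf + /sg].
Qed.

Lemma smooth_atV f z : smooth_at f z -> f z != 0 ->
  smooth_at (fun y => (f y)^-1) z.
Proof.
move=> sf f0; have /differentiable_continuous cf := smooth_at_differentiable sf.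
have /nbhs_interior := cf _ (open_nbhs_nbhs (conj (@open_neq _ 0) f0)).
case/smooth_atP: sf => V [oV Vz sf].
move=> /near_openP[W [oW Wz W0]].
have oVW : open (V `&` W) by apply: openI.
apply/smooth_atP; exists (V `&` W); split=> //; apply: smooth_closureP => //.
apply: closureV; first by apply: closure_smooth => y [/sf].
by move=> y [_ /W0 /nbhs_singleton].
Qed.

Lemma smooth_at_comp f phi z :
  smooth_at f (phi z) -> smooth_map_at phi z -> smooth_at (f \o phi) z.
Proof.
move=> /smooth_atP[W [oW Wz sf]] sphi.
have cphi := smooth_map_at_continuous sphi.
have : \forall y \near z, W (phi y) /\
    forall k s, differentiable (pderivs s (fun y => phi y 0 k)) y.
  have WN : \forall y \near z, W (phi y) by exact: cphi (open_nbhs_nbhs (conj oW Wz)).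
  near=> y; split; first by near: y.
  by near: y; apply: filter_forall => k; apply: sphi.
move=> /near_openP[V [oV Vz WV]].
apply/smooth_atP; exists V; split=> //; apply: smooth_closureP => //.
by apply: closure_comp sf _ => [y /WV[]//|k y /WV[_ /(_ k)]].
Unshelve. all: by end_near. Qed.

Lemma smooth_at_sum I (r : seq I) (P : pred I) (F : I -> 'rV[R]_n -> R) z :
  (forall i, P i -> smooth_at (F i) z) ->
  smooth_at (fun y => \sum_(i <- r | P i) F i y) z.
Proof.
move=> sF; elim: r => [|i r IH].
  rewrite (_ : (fun _ => _) = fun=> 0); first exact: smooth_at_cst.
  by apply/funext => y; rewrite big_nil.
have [Pi|/negPf Pi] := boolP (P i); last first.
  by congr smooth_at: IH; apply/funext => y; rewrite big_cons Pi.
rewrite (_ : (fun _ => _) = F i \+ fun y => \sum_(j <- r | P j) F j y).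
  by apply: smooth_atD IH; apply: sF.
by apply/funext => y; rewrite big_cons Pi.
Qed.

Lemma smooth_at_prod I (r : seq I) (P : pred I) (F : I -> 'rV[R]_n -> R) z :
  (forall i, P i -> smooth_at (F i) z) ->
  smooth_at (fun y => \prod_(i <- r | P i) F i y) z.
Proof.
move=> sF; elim: r => [|i r IH].
  rewrite (_ : (fun _ => _) = fun=> 1); first exact: smooth_at_cst.
  by apply/funext => y; rewrite big_nil.
have [Pi|/negPf Pi] := boolP (P i); last first.
  by congr smooth_at: IH; apply/funext => y; rewrite big_cons Pi.
rewrite (_ : (fun _ => _) = F i \* fun y => \prod_(j <- r | P j) F j y).
  by apply: smooth_atM IH; apply: sF.
by apply/funext => y; rewrite big_cons Pi.
Qed.

Lemma smooth_atX f m z : smooth_at f z -> smooth_at (fun y => f y ^+ m) z.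
Proof.
move=> sf; elim: m => [|m IH]; first exact: smooth_at_cst.
rewrite (_ : (fun _ => _) = f \* fun y => f y ^+ m); first exact: smooth_atM.
by apply/funext => y; rewrite exprS.
Qed.

Lemma smooth_map_at_comp phi psi z :
  smooth_map_at psi (phi z) -> smooth_map_at phi z -> smooth_map_at (psi \o phi) z.
Proof. by move=> spsi sphi k; apply: (smooth_at_comp (spsi k)). Qed.

Lemma smooth_map_at_affine phi z : affine_map phi -> smooth_map_at phi z.
Proof.
move=> [A [b phiE]] k.
suff -> : (fun y => phi y 0 k) = (fun y => \sum_i y 0 i * A i k) \+ (fun=> b 0 k).
  apply: smooth_atD; last exact: smooth_at_cst.
  apply: smooth_at_sum => i _; apply: smooth_atM; first exact: smooth_at_coord.
  exact: smooth_at_cst.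
by apply/funext => y; rewrite phiE !mxE.
Qed.

Lemma diffeomorphism_comp phi psi :
  diffeomorphism phi -> diffeomorphism psi -> diffeomorphism (psi \o phi).
Proof.
move=> [phi' [K1 K2 s1 s2]] [psi' [K3 K4 s3 s4]]; exists (phi' \o psi'); split.
- exact: can_comp.
- exact: can_comp.
- by move=> y; apply: smooth_map_at_comp.
- by move=> y; apply: smooth_map_at_comp.
Qed.

(* The inverse is the limit, reached after finitely many steps, of the
   iteration [h y = y - P (h y)]. *)
Lemma triangular_diffeomorphism (w : 'I_n -> nat) (P : 'I_n -> 'rV[R]_n -> R)
    phi :
  (forall k z, smooth_at (P k) z) ->
  (forall k z z', (forall i, (w i < w k)%N -> z 0 i = z' 0 i) ->
     P k z = P k z') ->
  (forall z k, phi z 0 k = z 0 k + P k z) ->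
  diffeomorphism phi.
Proof.
move=> sP Pw phiE.
pose step (y h : 'rV[R]_n) : 'rV[R]_n := \row_k (y 0 k - P k h).
pose h m y := iter m (step y) y.
pose N := (\max_k (w k).+1)%N.
have wN k : (w k < N)%N by rewrite /N; apply: (@leq_bigmax _ (fun k => (w k).+1)).
have hS m y k : (w k < m)%N -> h m.+1 y 0 k = h m y 0 k.
  elim: m k => // m IH k km.
  rewrite [h m.+2 y]/= [h m.+1 y in RHS]/= !mxE; congr (_ - _).
  apply: Pw => i ik; apply: IH; exact: leq_trans ik km.
exists (h N); split.
- move=> z; apply/rowP => k; move: (N) (wN k) => m; elim: m k => // m IH k km.
  rewrite /= mxE phiE (Pw _ (h m (phi z)) z) ?addrK // => i ik.
  by apply: IH; apply: leq_trans ik km.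
- move=> y; apply/rowP => k; rewrite phiE -{1}hS ?wN //= mxE.
  exact: subrK.
- move=> z k; under eq_fun do rewrite phiE.
  by apply: smooth_atD; [apply: smooth_at_coord|apply: sP].
- move=> y; move: (N) => m; elim: m => [|m IH] k; first exact: smooth_at_coord.
  suff -> : (fun z => h m.+1 z 0 k) =
      (fun z => z 0 k) \+ ((fun=> -1) \* (P k \o h m)).
    apply: smooth_atD; first exact: smooth_at_coord.
    apply: smooth_atM; first exact: smooth_at_cst.
    exact: smooth_at_comp.
  by apply/funext => z; rewrite /= mxE mulN1r.
Qed.

End SmoothAt.

(** * Smooth functions and tangent vectors on a manifold *)

Section Manifold.
Context {R : realType} {n : nat} {M : manifold R n}.
Implicit Types (c d : chart R M n) (p q : M) (f g : M -> R) (v : functional M).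

Lemma atlas_chart c : atlas c -> is_chart c.
Proof. by case: M c => ? ? ? ? cP ? ? ? c; apply: cP. Qed.

Lemma atlas_cover p : exists2 c, atlas c & cdom c p.
Proof. by case: M p. Qed.

Lemma atlas_compatible c d : atlas c -> atlas d -> compatible c d.
Proof. by case: M c d => ? ? ? ? ? ? cP ? c d; apply: cP. Qed.

Lemma atlas_maximal c :
  is_chart c -> (forall d, atlas d -> compatible c d) -> atlas c.
Proof. by case: M c => ? ? ? ? ? ? ? cP c; apply: cP. Qed.

Lemma cmapK c p : atlas c -> cdom c p -> cinv c (cmap c p) = p.
Proof. by move=> /atlas_chart[_ _ + _ _]; apply. Qed.

Lemma near_cdom c p : atlas c -> cdom c p -> \forall q \near p, cdom c q.
Proof. by move=> /atlas_chart[oc _ _ _ _] cp; apply: open_nbhs_nbhs. Qed.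

Lemma near_cinv c p (P : set M) : atlas c -> cdom c p ->
  (\forall q \near p, P q) -> \forall z \near cmap c p, P (cinv c z).
Proof.
move=> ac cp Pp; have [_ _ _ _ /(_ p cp) cc] := atlas_chart ac.
by apply: cc; rewrite cmapK.
Qed.

Lemma near_cmap c p (P : set 'rV[R]_n) : atlas c -> cdom c p ->
  (\forall z \near cmap c p, P z) -> \forall q \near p, P (cmap c q).
Proof.
by move=> ac cp Pp; have [_ _ _ /(_ p cp) cc _] := atlas_chart ac; apply: cc.
Qed.

Lemma smooth_fun_atP c p f : atlas c -> cdom c p ->
  smooth_fun_at f p <-> smooth_at (f \o cinv c) (cmap c p).
Proof.
move=> ac cp; split=> [/(_ c ac cp)//|sf d ad dp].
have [_ sdc] := atlas_compatible ac ad cp dp.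
have : smooth_at ((f \o cinv c) \o (cmap c \o cinv d)) (cmap d p).
  by apply: smooth_at_comp => //=; rewrite cmapK.
apply: smooth_at_eq; have := near_cinv ad dp (near_cdom ac cp).
by apply: filterS => z zc /=; rewrite cmapK.
Qed.

Lemma smooth_fun_near f p : smooth_fun_at f p ->
  \forall q \near p, smooth_fun_at f q.
Proof.
move=> sf; have [c ac cp] := atlas_cover p.
have /smooth_at_near/(near_cmap ac cp) := (smooth_fun_atP f ac cp).1 sf.
move: (near_cdom ac cp); apply: filterS2 => q cq sq.
exact/(smooth_fun_atP f ac cq).
Qed.

Lemma near_eq_cinv c p f g : atlas c -> cdom c p ->
  (\forall q \near p, f q = g q) ->
  \forall z \near cmap c p, (f \o cinv c) z = (g \o cinv c) z.
Proof. exact: near_cinv. Qed.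

Lemma smooth_fun_eq f g p : (\forall q \near p, f q = g q) ->
  smooth_fun_at f p -> smooth_fun_at g p.
Proof.
move=> fg sf c ac cp; apply: smooth_at_eq (sf c ac cp).
exact: near_eq_cinv.
Qed.

Lemma smooth_fun_cst (k : R) p : smooth_fun_at (fun=> k) p.
Proof. by move=> c ac cp; apply: smooth_at_cst. Qed.

Lemma smooth_funD f g p : smooth_fun_at f p -> smooth_fun_at g p ->
  smooth_fun_at (f \+ g) p.
Proof. by move=> sf sg c ac cp; apply: smooth_atD; [apply: sf|apply: sg]. Qed.

Lemma smooth_funM f g p : smooth_fun_at f p -> smooth_fun_at g p ->
  smooth_fun_at (f \* g) p.
Proof. by move=> sf sg c ac cp; apply: smooth_atM; [apply: sf|apply: sg]. Qed.

Lemma smooth_funV f p : smooth_fun_at f p -> f p != 0 ->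
  smooth_fun_at (fun q => (f q)^-1) p.
Proof.
move=> sf f0 c ac cp; apply: smooth_atV; first exact: sf.
by rewrite /= cmapK.
Qed.

Lemma smooth_fun_sum I (r : seq I) (P : pred I) (F : I -> M -> R) p :
  (forall i, P i -> smooth_fun_at (F i) p) ->
  smooth_fun_at (fun q => \sum_(i <- r | P i) F i q) p.
Proof.
move=> sF c ac cp; apply: (@smooth_at_sum _ _ _ r P (fun i => F i \o cinv c)).
by move=> i Pi; apply: sF.
Qed.

Lemma smooth_fun_prod I (r : seq I) (P : pred I) (F : I -> M -> R) p :
  (forall i, P i -> smooth_fun_at (F i) p) ->
  smooth_fun_at (fun q => \prod_(i <- r | P i) F i q) p.
Proof.
move=> sF c ac cp; apply: (@smooth_at_prod _ _ _ r P (fun i => F i \o cinv c)).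
by move=> i Pi; apply: sF.
Qed.

Lemma smooth_fun_comp (phi : 'rV[R]_n -> R) c p : atlas c -> cdom c p ->
  smooth_at phi (cmap c p) -> smooth_fun_at (phi \o cmap c) p.
Proof.
move=> ac cp sphi d ad dp.
apply: (@smooth_at_comp _ _ phi (cmap c \o cinv d)).
  by rewrite /= cmapK.
by have [] := atlas_compatible ac ad cp dp.
Qed.

Lemma smooth_fun_coord c k p : atlas c -> cdom c p -> smooth_fun_at (coord c k) p.
Proof.
move=> ac cp; apply: (@smooth_fun_comp (fun z => z 0 k)) => //.
exact: smooth_at_coord.
Qed.

Lemma smooth_fun_det m (A : M -> 'M[R]_m) p :
  (forall i j, smooth_fun_at (fun q => A q i j) p) ->
  smooth_fun_at (fun q => \det (A q)) p.
Proof.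
move=> sA; apply: smooth_fun_sum => s _; apply: smooth_funM.
  exact: smooth_fun_cst.
by apply: smooth_fun_prod => i _; apply: sA.
Qed.

(** Cramer's rule: the entries of the inverse are cofactors divided by the determinant. *)
Lemma smooth_fun_invmx m (A : M -> 'M[R]_m) p :
  (forall i j, smooth_fun_at (fun q => A q i j) p) ->
  (\forall q \near p, A q \in unitmx) ->
  forall i j, smooth_fun_at (fun q => invmx (A q) i j) p.
Proof.
move=> sA Au i j.
apply: (@smooth_fun_eq ((fun q => (\det (A q))^-1) \* (fun q => cofactor (A q) j i))).
  apply: filterS Au => q Aq.
  by rewrite /invmx Aq !mxE.
apply: smooth_funM; first apply: smooth_funV.
- exact: smooth_fun_det.
- by have /nbhs_singleton := Au; rewrite unitmxE unitfE.
apply: smooth_funM; first exact: smooth_fun_cst.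
apply: smooth_fun_det => k l.
rewrite (_ : (fun q => _) = fun q => A q (lift j k) (lift i l)) //.
by apply/funext => q; rewrite !mxE.
Qed.

Lemma coord_vectorE c k p f : smooth_fun_at f p ->
  coord_vector c k p f = pderiv k (f \o cinv c) (cmap c p).
Proof. by rewrite /coord_vector; case: asboolP. Qed.

(** The chain rule for the transition map from [c] to [d]. For [f] not smooth at [p] both sides are
    0, by the default value in [coord_vector]. *)
Lemma coord_vector_change c d k p f : atlas c -> cdom c p ->
  atlas d -> cdom d p ->
  coord_vector c k p f =
    \sum_l coord_vector c k p (coord d l) * coord_vector d l p f.
Proof.
move=> ac cp ad dp; case: (pselect (smooth_fun_at f p)) => sf; last first.
  rewrite {1}/coord_vector; case: asboolP => // _.
  rewrite big1 // => l _; rewrite /coord_vector; case: (asboolP (smooth_fun_at f p)) => //.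
  by rewrite mulr0.
have [_ scd] := atlas_compatible ad ac dp cp.
rewrite coord_vectorE //.
transitivity (pderiv k ((f \o cinv d) \o (cmap d \o cinv c)) (cmap c p)).
  apply: near_eq_derive; have := near_cinv ac cp (near_cdom ad dp).
  by apply: filterS => z zd /=; rewrite cmapK.
rewrite pderiv_comp; first last.
- by move=> l; apply: smooth_at_differentiable (scd l).
- by apply: smooth_at_differentiable; rewrite /= cmapK //; apply: sf.
apply: eq_bigr => l _; rewrite !coord_vectorE //=; last exact: smooth_fun_coord.
by rewrite cmapK.
Qed.

Lemma coord_vector_coord c k l p : atlas c -> cdom c p ->
  coord_vector c k p (coord c l) = (k == l)%:R.
Proof.
move=> ac cp; rewrite coord_vectorE; last exact: smooth_fun_coord.
rewrite -(pderiv_coord k l (cmap c p)); apply: near_eq_derive.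
have [_ oc _ _ _] := atlas_chart ac.
have : nbhs (cmap c p) (cmap c @` cdom c).
  by apply: open_nbhs_nbhs; split=> //; exists p.
by apply: filterS => _ [q cq <-] /=; rewrite /coord cmapK.
Qed.

Lemma tangent_coordE v p c : tangent_space p v -> atlas c -> cdom c p ->
  v = \sum_l v (coord c l) *: coord_vector c l p.
Proof.
move=> [d [ad dp [u ->]]] ac cp; apply/funext => f.
rewrite !fct_sumE /=.
transitivity (\sum_k u 0 k * \sum_l coord_vector d k p (coord c l) * coord_vector c l p f).
  by apply: eq_bigr => k _; rewrite -coord_vector_change.
under [LHS]eq_bigr => k _ do rewrite mulr_sumr.
rewrite exchange_big /=; apply: eq_bigr => l _.
rewrite [RHS]mulr_suml; apply: eq_bigr => k _.
by rewrite mulrA.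
Qed.

Lemma tangentE v p c f : tangent_space p v -> atlas c -> cdom c p ->
  v f = \sum_l v (coord c l) * coord_vector c l p f.
Proof. by move=> tv ac cp; rewrite {1}(tangent_coordE tv ac cp) fct_sumE. Qed.

(** The default value 0 on non-smooth functions is harmless here: smoothness at [p] depends only on
    the germ, as does each partial derivative. *)
Lemma tangent_near v p f g : tangent_space p v ->
  (\forall q \near p, f q = g q) -> v f = v g.
Proof.
move=> tv fg; have [c ac cp] := atlas_cover p.
rewrite !(tangentE _ tv ac cp); apply: eq_bigr => l _; congr (_ * _).
have gf : \forall q \near p, g q = f q by apply: filterS fg.
rewrite /coord_vector; case: asboolP => sf; case: asboolP => sg //.
- by apply: near_eq_derive; apply: near_eq_cinv.
- by case: sg; apply: smooth_fun_eq sf.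
- by case: sf; apply: smooth_fun_eq sg.
Qed.

Lemma tangent_cst v p (k : R) : tangent_space p v -> v (fun=> k) = 0.
Proof.
move=> tv; have [c ac cp] := atlas_cover p.
rewrite (tangentE _ tv ac cp) big1 // => l _.
by rewrite coord_vectorE ?pderiv_cst ?mulr0 //; apply: smooth_fun_cst.
Qed.

Lemma tangentD v p f g : tangent_space p v ->
  smooth_fun_at f p -> smooth_fun_at g p -> v (f \+ g) = v f + v g.
Proof.
move=> tv sf sg; have [c ac cp] := atlas_cover p.
rewrite !(tangentE _ tv ac cp) -big_split /=; apply: eq_bigr => l _.
rewrite !coord_vectorE ?mulrDr //; last exact: smooth_funD.
rewrite -mulrDr; congr (_ * _).
by apply: pderivD; apply: smooth_at_differentiable; [apply: sf|apply: sg].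
Qed.

Lemma tangentM v p f g : tangent_space p v ->
  smooth_fun_at f p -> smooth_fun_at g p ->
  v (f \* g) = v f * g p + f p * v g.
Proof.
move=> tv sf sg; have [c ac cp] := atlas_cover p.
rewrite !(tangentE _ tv ac cp) mulr_suml mulr_sumr -big_split /=.
apply: eq_bigr => l _.
rewrite !coord_vectorE //; last exact: smooth_funM.
transitivity (v (coord c l) * pderiv l ((f \o cinv c) \* (g \o cinv c)) (cmap c p)).
  by [].
rewrite pderivM /= ?cmapK //.
- by ring.
- by apply: smooth_at_differentiable; apply: sf.
- by apply: smooth_at_differentiable; apply: sg.
Qed.

Lemma tangent_sum v p I (r : seq I) (F : I -> M -> R) : tangent_space p v ->
  (forall i, smooth_fun_at (F i) p) ->
  v (fun q => \sum_(i <- r) F i q) = \sum_(i <- r) v (F i).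
Proof.
move=> tv sF; elim: r => [|i r IH].
  rewrite big_nil -[RHS](@tangent_cst v p 0 tv); congr v.
  by apply/funext => q; rewrite big_nil.
rewrite big_cons -IH -(tangentD tv) //; last exact: smooth_fun_sum.
by congr v; apply/funext => q; rewrite big_cons.
Qed.

End Manifold.

(** * Words, multi-indices and triangular systems *)

(** The exchange hypothesis is limited to rearrangements of [s0], as exchanges will be justified
    only for words of a given length and weight. One letter at a time is carried to its final
    place. *)
Lemma perm_eq_swap_invariant (T : eqType) (V : Type) (F : seq T -> V) (s0 : seq T) :
  (forall s1 x y s2, perm_eq (s1 ++ x :: y :: s2) s0 ->
     F (s1 ++ x :: y :: s2) = F (s1 ++ y :: x :: s2)) ->
  forall s, perm_eq s s0 -> F s = F s0.
Proof.
move=> swap.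
have move_right x t1 t2 A : perm_eq (A ++ x :: t1 ++ t2) s0 ->
    F (A ++ x :: t1 ++ t2) = F (A ++ t1 ++ x :: t2).
  elim: t1 A => //= y t1 IH A p; rewrite swap // -!(cat_rcons y) IH //.
  rewrite cat_rcons; apply: perm_trans p.
  by rewrite perm_cat2l (perm_catCA [:: y] [:: x]).
(* [A] is the prefix of letters already in place; it is carried along because [swap] speaks of whole
   words. *)
suff ind A s t : perm_eq s t -> perm_eq (A ++ s) s0 -> F (A ++ s) = F (A ++ t).
  by move=> s p; apply: (ind [::]).
elim: s A t => [|x s IH] A t p p0.
  by move: p; rewrite perm_sym => /perm_nilP ->.
have xt : x \in t by rewrite -(perm_mem p) mem_head.
case/splitPr: t / xt p => t1 t2 p.
have {}p : perm_eq s (t1 ++ t2).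
  by rewrite -(perm_cons x) (permPl p) (perm_catCA t1 [:: x]).
rewrite -cat_rcons (IH _ _ p) cat_rcons // move_right //.
by apply: perm_trans p0; rewrite perm_cat2l perm_cons perm_sym.
Qed.

Section Triangular.
Context {F : fieldType} {T : finType} (Q : pred T) (s : T -> nat)
  (m : T -> T -> F).
Hypothesis m_tri : forall x y, Q x -> Q y -> (s y <= s x)%N ->
  (m y x != 0) = (x == y).

(** Substitution along the levels of [s]: changing [c] on level [N] does not disturb the equations
    of lower level, and within level [N] the matrix is diagonal, so dividing the residual by the
    diagonal entry solves the equations there. *)
Lemma triangular_solution (b : T -> F) :
  exists c : T -> F, forall y, Q y -> \sum_(x | Q x) m y x * c x = b y.
Proof.
suff [c cP] : exists c : T -> F, forall y, Q y -> (s y < \max_x (s x).+1)%N ->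
    \sum_(x | Q x) m y x * c x = b y.
  by exists c => y Qy; apply: cP => //; apply: (@leq_bigmax _ (fun x => (s x).+1)).
elim: (\max_x _)%N => [|N [c cP]]; first by exists (fun=> 0).
pose e y := (b y - \sum_(x | Q x) m y x * c x) / m y y.
exists (fun x => if s x == N then c x + e x else c x) => y Qy.
rewrite ltnS leq_eqVlt => /orP[/eqP sy|sy].
  rewrite (bigD1 y) //= sy eqxx.
  have := m_tri Qy Qy (leqnn _); rewrite eqxx => myy.
  rewrite (_ : \sum_(_ | _) _ = \sum_(x | Q x && (x != y)) m y x * c x).
    rewrite mulrDr /e mulrC [_ * (_ / _)]mulrC divfK //.
    by rewrite [X in _ - X](bigD1 y) //= [c y * _]mulrC; ring.
  apply: eq_bigr => x /andP[Qx xy]; case: eqP => // sx.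
  have := m_tri Qx Qy; rewrite sx sy leqnn (negPf xy) => /(_ isT)/negbFE/eqP ->.
  by rewrite !mul0r.
rewrite -cP //; apply: eq_bigr => x Qx; case: eqP => // sx.
have := m_tri Qx Qy; rewrite sx ltnW // => /(_ isT).
have /negPf -> : x != y by apply: contraTneq sy => <-; rewrite sx ltnn.
by move=> /negbFE/eqP ->; rewrite !mul0r.
Qed.

(** In the equation [y], the unknowns of level below [s y] agree by induction and all others except
    [y] have coefficient 0, so the nonzero diagonal entry can be cancelled. *)
Lemma triangular_unique (c d : T -> F) :
  (forall y, Q y -> \sum_(x | Q x) m y x * c x = \sum_(x | Q x) m y x * d x) ->
  forall y, Q y -> c y = d y.
Proof.
move=> cd y; have [N] := ubnP (s y); elim: N y => // N IH y sy Qy.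
have := cd y Qy; rewrite (bigD1 y) //= [in RHS](bigD1 y) //=.
have -> : \sum_(x | Q x && (x != y)) m y x * c x =
          \sum_(x | Q x && (x != y)) m y x * d x.
  apply: eq_bigr => x /andP[Qx xy]; have [sx|sx] := ltnP (s x) (s y).
    by rewrite IH // (leq_trans sx).
  have := m_tri Qx Qy sx; rewrite (negPf xy) => /negbFE/eqP ->.
  by rewrite !mul0r.
move=> /addIr/mulfI; apply.
by have := m_tri Qy Qy (leqnn _); rewrite eqxx.
Qed.

End Triangular.

Definition ord_leq n : rel 'I_n := fun i j => (i <= j)%N.

Section MultiIndex.
Context {n m : nat}.
Implicit Types (alpha : {ffun 'I_n -> 'I_m}) (I : seq 'I_n).

(** The bound [m] on the entries keeps multi-indices in a finite type. The concatenated word is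
    already increasing; [sort] makes this immediate and is invisible to sums, products and
    counts. *)
Definition multi_word alpha : seq 'I_n :=
  sort (@ord_leq n) (flatten [seq nseq (alpha i) i | i <- enum 'I_n]).

Lemma multi_word_big (V : Type) (idx : V) (op : Monoid.com_law idx)
    (F : 'I_n -> V) alpha :
  \big[op/idx]_(i <- multi_word alpha) F i =
  \big[op/idx]_i iter (alpha i) (op (F i)) idx.
Proof.
rewrite (perm_big _ (permEl (perm_sort _ _))) big_flatten big_map /=.
rewrite big_enum /=; apply: eq_bigr => i _.
by rewrite big_nseq.
Qed.

Lemma size_multi_word alpha : size (multi_word alpha) = (\sum_i alpha i)%N.
Proof.
rewrite -sum1_size multi_word_big; apply: eq_bigr => i _.
by rewrite iter_addn_0 mul1n.
Qed.

Lemma prod_multi_word (R : comNzRingType) (F : 'I_n -> R) alpha :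
  \prod_(i <- multi_word alpha) F i = \prod_i F i ^+ alpha i.
Proof.
by rewrite multi_word_big; apply: eq_bigr => i _; rewrite iter_mulr_1.
Qed.

Lemma sum_multi_word (w : 'I_n -> nat) alpha :
  (\sum_(i <- multi_word alpha) w i = \sum_i w i * alpha i)%N.
Proof.
rewrite multi_word_big; apply: eq_bigr => i _.
by rewrite iter_addn_0.
Qed.

Lemma count_multi_word alpha i : count_mem i (multi_word alpha) = alpha i.
Proof.
rewrite -sum1_count big_mkcond multi_word_big (bigD1 i) //= eqxx.
rewrite iter_addn_0 mul1n big1 ?addn0 // => j /negPf ->.
by rewrite iter_addn_0.
Qed.

Lemma sorted_multi_word I : sorted (@ord_leq n) I -> (forall i, (count_mem i I < m)%N) ->
  exists alpha, I = multi_word alpha.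
Proof.
move=> sI cI; exists [ffun i => Ordinal (cI i)].
apply: (@sorted_eq _ (@ord_leq n)) => //.
- by move=> x y z; apply: leq_trans.
- by move=> x y /anti_leq/val_inj.
- by apply: sort_sorted => x y; apply: leq_total.
- by apply/allP => i _; apply/eqP; rewrite count_multi_word ffunE.
Qed.

End MultiIndex.

(** * Words of vector fields evaluated at a point *)

Section Words.
Context {R : realType} {n r : nat} {M : carnot_manifold R n r} (U : set M)
  (X : 'I_n -> field M) (a : M).
Hypotheses (oU : open U) (vX : forall j, vector_field U (X j)) (Ua : U a).
Implicit Types (f g h : M -> R) (I J : seq 'I_n).

Let near_U : \forall p \near a, U p.
Proof. exact: open_nbhs_nbhs. Qed.

Lemma field_tangent j p : U p -> tangent_space p (X j p).
Proof. by move=> /(vX j)[]. Qed.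

Lemma smooth_apply_field j f :
  smooth_fun_at f a -> smooth_fun_at (apply_field (X j) f) a.
Proof. by move: f; have [] := vX j Ua. Qed.

Lemma smooth_word I f : smooth_fun_at f a -> smooth_fun_at (apply_word X I f) a.
Proof. by move=> sf; elim: I => //= i I; apply: smooth_apply_field. Qed.

Lemma word_rcons I i f :
  apply_word X (rcons I i) f = apply_word X I (apply_field (X i) f).
Proof. exact: foldr_rcons. Qed.

Lemma word_cat I J f :
  apply_word X (I ++ J) f = apply_word X I (apply_word X J f).
Proof. exact: foldr_cat. Qed.

Lemma word_near_eq I f g : (\forall p \near a, f p = g p) ->
  \forall p \near a, apply_word X I f p = apply_word X I g p.
Proof.
move=> fg; elim: I => //= i I /near_join; move: near_U.
by apply: filterS2 => p Up; apply: tangent_near; apply: field_tangent.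
Qed.

Lemma word_eq I f g : (\forall p \near a, f p = g p) ->
  apply_word X I f a = apply_word X I g a.
Proof. by move=> /(word_near_eq I)/nbhs_singleton. Qed.

Lemma apply_fieldD i f g : smooth_fun_at f a -> smooth_fun_at g a ->
  \forall p \near a, apply_field (X i) (f \+ g) p =
    (apply_field (X i) f \+ apply_field (X i) g) p.
Proof.
move=> /smooth_fun_near sf /smooth_fun_near sg; near=> p.
by apply: (@tangentD _ _ _ _ p); [apply: field_tangent|..]; near: p.
Unshelve. all: by end_near. Qed.

Lemma apply_fieldM i f g : smooth_fun_at f a -> smooth_fun_at g a ->
  \forall p \near a, apply_field (X i) (f \* g) p =
    ((apply_field (X i) f \* g) \+ (f \* apply_field (X i) g)) p.
Proof.
move=> /smooth_fun_near sf /smooth_fun_near sg; near=> p.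
by apply: (@tangentM _ _ _ _ p); [apply: field_tangent|..]; near: p.
Unshelve. all: by end_near. Qed.

Lemma wordD I f g : smooth_fun_at f a -> smooth_fun_at g a ->
  apply_word X I (f \+ g) a = apply_word X I f a + apply_word X I g a.
Proof.
elim/last_ind: I f g => // I i IH f g sf sg.
rewrite !word_rcons (word_eq I (apply_fieldD i sf sg)).
by apply: IH; apply: smooth_apply_field.
Qed.

Lemma word_derivation I i f g : smooth_fun_at f a -> smooth_fun_at g a ->
  apply_word X (rcons I i) (f \* g) a =
    apply_word X I (apply_field (X i) f \* g) a +
    apply_word X I (f \* apply_field (X i) g) a.
Proof.
move=> sf sg; rewrite word_rcons (word_eq I (apply_fieldM i sf sg)).
by apply: wordD; apply: smooth_funM => //; apply: smooth_apply_field.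
Qed.

(** By the Leibniz rule [X_I(fg)] is a sum of products whose second factor is [X_J g] with [J] a
    subword of [I]. This absorbs the variable coefficients of a bracket. *)
Lemma word_mul_eq0 I f g : smooth_fun_at f a -> smooth_fun_at g a ->
  (forall J, subseq J I -> apply_word X J g a = 0) ->
  apply_word X I (f \* g) a = 0.
Proof.
elim/last_ind: I f g => [|I i IH] f g sf sg g0.
  by have g0a : g a = 0 := g0 [::] isT; rewrite /= g0a mulr0.
rewrite word_derivation // !IH ?addr0 //; try exact: smooth_apply_field.
  move=> J JI; rewrite -word_rcons; apply: g0.
  by rewrite -!cats1 cat_subseq.
by move=> J JI; apply: g0; apply: subseq_trans (subseq_rcons _ _).
Qed.

Lemma word_cst I (k : R) :
  apply_word X I (fun=> k) a = if I is [::] then k else 0.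
Proof.
case/lastP: I => // I i; rewrite word_rcons.
rewrite (@word_eq I _ (fun=> 0)); last first.
  move: near_U; apply: filterS => p Up.
  exact: (@tangent_cst _ _ _ _ p k (field_tangent i Up)).
have -> : apply_word X I (fun=> 0) a = 0.
  elim/last_ind: I => // I j IH; rewrite word_rcons -[RHS]IH; apply: word_eq.
  move: near_U; apply: filterS => p Up.
  exact: (@tangent_cst _ _ _ _ p 0 (field_tangent j Up)).
by case: I.
Qed.

Lemma wordZ I (k : R) f : smooth_fun_at f a ->
  apply_word X I (fun p => k * f p) a = k * apply_word X I f a.
Proof.
elim/last_ind: I f => // I i IH f sf.
have sk := @smooth_fun_cst _ _ M k a.
rewrite !word_rcons -IH; last exact: smooth_apply_field.
apply: word_eq; have := apply_fieldM i sk sf; move: near_U; apply: filterS2.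
move=> p Up e; apply: (etrans e) => /=.
by rewrite [X in X * _]/apply_field (tangent_cst _ (field_tangent i Up)) mul0r add0r.
Qed.

Lemma word_sum I T (s : seq T) (P : pred T) (F : T -> M -> R) :
  (forall t, smooth_fun_at (F t) a) ->
  apply_word X I (fun p => \sum_(t <- s | P t) F t p) a =
    \sum_(t <- s | P t) apply_word X I (F t) a.
Proof.
move=> sF; elim: s => [|t s IH].
  rewrite big_nil (_ : (fun _ => _) = fun=> 0); last first.
    by apply/funext => p; rewrite big_nil.
  by rewrite word_cst; case: I.
rewrite big_cons (_ : (fun _ => _) = if P t
    then F t \+ (fun p => \sum_(t <- s | P t) F t p)
    else (fun p => \sum_(t <- s | P t) F t p)); last first.
  by apply/funext => p; rewrite big_cons; case: ifP.
by case: ifP => // _; rewrite wordD ?IH //; apply: smooth_fun_sum.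
Qed.

(** Order of vanishing measured by length: each field counts for 1 instead of its weight. For a
    frame this is the usual order of vanishing at [a]. *)
Definition vanishing (m : nat) f :=
  forall I, (size I < m)%N -> apply_word X I f a = 0.

Lemma vanishing_apply_field m i f :
  vanishing m f -> vanishing m.-1 (apply_field (X i) f).
Proof.
case: m => // m vf I Im; rewrite -word_rcons; apply: vf.
by rewrite size_rcons.
Qed.

Lemma vanishingM m m' f g : smooth_fun_at f a -> smooth_fun_at g a ->
  vanishing m f -> vanishing m' g -> vanishing (m + m') (f \* g).
Proof.
move=> sf sg vf vg I; elim/last_ind: I m m' f g sf sg vf vg => [|I i IH] m m' f g sf sg vf vg.
  case: m vf => [|m] vf.
    case: m' vg => // m' vg _.
    by have ga : g a = 0 := vg [::] isT; rewrite /= ga mulr0.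
  by have fa : f a = 0 := vf [::] isT; rewrite /= fa mul0r.
rewrite size_rcons => Im; rewrite word_derivation //.
(* If [m] is 0 then so is [m.-1]; the removal of the letter [i] still leaves [size I < m.-1 + m'],
   and likewise for [m']. *)
rewrite (IH m.-1 m') ?(IH m m'.-1) ?addr0 //;
  try exact: smooth_apply_field; try exact: vanishing_apply_field; lia.
Qed.

(** * Words applied to monomials in linearly adapted coordinates *)

Section Monomials.
Context (y : 'I_n -> M -> R).
Hypotheses (sy : forall k, smooth_fun_at (y k) a) (y0 : forall k, y k a = 0)
  (dy : forall j k, X j a (y k) = (j == k)%:R).

Definition monomial J : M -> R := fun p => \prod_(j <- J) y j p.

Lemma smooth_monomial J : smooth_fun_at (monomial J) a.
Proof. by apply: smooth_fun_prod. Qed.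

Lemma monomial_cons j J : monomial (j :: J) = y j \* monomial J.
Proof. by apply/funext => p; rewrite /monomial big_cons. Qed.

Lemma vanishing_coord j : vanishing 1 (y j).
Proof. by case=> //= _; apply: y0. Qed.

Lemma vanishing_monomial J : vanishing (size J) (monomial J).
Proof.
elim: J => // j J IH; rewrite monomial_cons.
exact: vanishingM (sy j) (smooth_monomial J) (vanishing_coord j) IH.
Qed.

(** In the Leibniz expansion exactly one field must hit [y j]: if none does, the factor [y j]
    vanishes at [a], and if two or more do, too few are left for [h]. The sum runs over the position
    of that field, which contributes 1 if its letter is [j] and 0 otherwise. *)
Lemma word_mul_coord j I h : smooth_fun_at h a -> vanishing (size I).-1 h ->
  apply_word X I (y j \* h) a =
  \sum_(p < size I | nth j I p == j) apply_word X (take p I ++ drop p.+1 I) h a.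
Proof.
elim/last_ind: I h => [|I i IH] h sh vh.
  by rewrite big_ord0 /= y0 mul0r.
have sXh := smooth_apply_field i sh.
rewrite size_rcons /= in vh.
rewrite word_derivation // IH //; last exact: vanishing_apply_field.
rewrite (_ : apply_word X I _ a = (i == j)%:R * apply_word X I h a); last first.
  (* [X_i y_j] is replaced by its value at [a]: the difference [g] vanishes there, so its product
     with [h] vanishes to one order more than [h], beyond the reach of the word [I]. *)
  pose g p := apply_field (X i) (y j) p + - (i == j)%:R.
  have sg : smooth_fun_at g a.
    by apply: smooth_funD; [apply: smooth_apply_field|apply: smooth_fun_cst].
  have vg : vanishing 1 g.
    by case=> //= _; rewrite /g /apply_field dy subrr.
  rewrite -wordZ // (_ : _ \* _ = (g \* h) \+ fun p => (i == j)%:R * h p).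
    rewrite wordD; last 2 first.
    - exact: smooth_funM.
    - by apply: smooth_funM => //; apply: smooth_fun_cst.
    by rewrite (vanishingM sg sh vg vh) ?add0r // add1n.
  by apply/funext => p /=; rewrite /g; ring.
rewrite size_rcons big_mkcond [in RHS]big_mkcond big_ord_recr /= addrC.
congr (_ + _); last first.
  apply: eq_bigr => p _; rewrite nth_rcons ltn_ord.
  by rewrite -word_rcons -cats1 -catA cats1 -drop_rcons // -cats1 takel_cat // ltnW.
rewrite nth_rcons ltnn eqxx -cats1 take_size_cat // drop_oversize ?cats0.
  by case: eqP => _; rewrite ?mul1r ?mul0r.
by rewrite size_cat addn1.
Qed.

(** The value is the product of the factorials of the multiplicities if [I] is a rearrangement of
    [J], and 0 otherwise. Only its being nonzero matters; nonnegativity is proved along with it so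
    that the terms produced by [word_mul_coord] cannot cancel. *)
Lemma word_monomial I J : size I = size J ->
  0 <= apply_word X I (monomial J) a /\
  (apply_word X I (monomial J) a != 0) = perm_eq I J.
Proof.
elim: J I => [|j J IH] I.
  move/size0nil => ->; rewrite /= /monomial big_nil.
  by rewrite ler01 oner_eq0.
move=> IJ; rewrite monomial_cons word_mul_coord; last 2 first.
- exact: smooth_monomial.
- by rewrite IJ; apply: vanishing_monomial.
have szd (p : 'I_(size I)) : size (take p I ++ drop p.+1 I) = size J.
  rewrite size_cat size_take ltn_ord size_drop; move: (ltn_ord p).
  by move: (val p) IJ => {}p /=; lia.
have permd (p : 'I_(size I)) : nth j I p == j ->
    perm_eq (take p I ++ drop p.+1 I) J = perm_eq I (j :: J).
  move=> /eqP pj; rewrite -(perm_cons j).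
  apply: (permPl _ (j :: J)).
  rewrite -[X in perm_eq _ X](cat_take_drop p I) (drop_nth j (ltn_ord p)) pj.
  by rewrite perm_sym -[j :: drop _ _]cat1s perm_catCA.
have F0 p : nth j I (p : 'I_(size I)) == j ->
    0 <= apply_word X (take p I ++ drop p.+1 I) (monomial J) a.
  by move=> _; have [] := IH _ (szd p).
split; first exact: sumr_ge0.
rewrite psumr_neq0 //; apply/hasP/idP => [[p _ /andP[pj]]|IJp].
  rewrite lt_neqAle eq_sym => /andP[+ _]; have [_ ->] := IH _ (szd p).
  by rewrite permd.
have jI : j \in I by rewrite (perm_mem IJp) mem_head.
have jp : (index j I < size I)%N by rewrite index_mem.
exists (Ordinal jp); first by rewrite mem_index_enum.
have pj : nth j I (Ordinal jp) == j by rewrite /= nth_index.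
rewrite pj /= lt_neqAle eq_sym.
have [ge0 ->] := IH _ (szd (Ordinal jp)).
by rewrite ge0 permd // IJp.
Qed.

End Monomials.
End Words.

(** * Frames of a Carnot manifold *)

Lemma word_weight_cat (R : realType) n r (M : carnot_manifold R n r)
    (I J : seq 'I_n) :
  word_weight M (I ++ J) = (word_weight M I + word_weight M J)%N.
Proof. exact: big_cat. Qed.

Lemma word_weight_cons (R : realType) n r (M : carnot_manifold R n r) i
    (I : seq 'I_n) :
  word_weight M (i :: I) = (weight M i + word_weight M I)%N.
Proof. exact: big_cons. Qed.

Lemma word_weight_perm (R : realType) n r (M : carnot_manifold R n r)
    (I J : seq 'I_n) : perm_eq I J -> word_weight M I = word_weight M J.
Proof. exact: perm_big. Qed.

Lemma word_weight_subseq (R : realType) n r (M : carnot_manifold R n r)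
    (I J : seq 'I_n) : subseq J I -> (word_weight M J <= word_weight M I)%N.
Proof.
move=> /subseqP[m _ ->]; elim: I m => [|i I IH] [|b m] //=.
  by rewrite /word_weight big_nil.
rewrite [leqRHS]word_weight_cons; case: b => /=.
  by rewrite word_weight_cons leq_add2l.
by rewrite (leq_trans (IH m)) // leq_addl.
Qed.

Section Frame.
Context {R : realType} {n r : nat} {M : carnot_manifold R n r} (U : set M)
  (X : 'I_n -> field M).
Hypothesis hX : h_frame U X.

Lemma step_gt0 : (0 < r)%N.
Proof. by case: M. Qed.

Lemma filt_subbundle w : (1 <= w <= r)%N -> subbundle (@filt _ _ _ M w) (rk M w).
Proof. by case: M w => ? ? ? ? sP ? ? ? w; apply: sP. Qed.

Lemma filt_leq w w' p : (1 <= w)%N -> (w <= w')%N -> (w' <= r)%N ->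
  @filt _ _ _ M w p `<=` @filt _ _ _ M w' p.
Proof.
move=> w1; elim: w' => [|w' IH]; first by case: w w1.
rewrite leq_eqVlt => /orP[/eqP -> _|ww' w'r]; first exact: subset_refl.
rewrite ltnS in ww'.
apply: subset_trans (IH ww' (ltnW w'r)) _.
have : (1 <= w' < r)%N by rewrite w'r (leq_trans w1).
by move: w' {IH ww' w'r} p; case: M => ? ? ? ? ? sP ? ? w' p /sP; apply.
Qed.

Lemma filt_full p : @filt _ _ _ M r p = tangent_space p.
Proof. by case: M p. Qed.

Lemma filt_bracket (V : set M) w w' Y Z :
  open V -> (1 <= w)%N -> (1 <= w')%N -> (w + w' <= r)%N ->
  section_of (@filt _ _ _ M w) V Y -> section_of (@filt _ _ _ M w') V Z ->
  section_of (@filt _ _ _ M (w + w')) V (bracket Y Z).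
Proof.
move: V Y Z; case: M => ? ? ? ? ? ? ? sP V Y Z oV w1 w'1 ww'.
exact: (sP w w' w1 w'1 ww').
Qed.

Lemma weight_gt0 (j : 'I_n) : (1 <= weight M j)%N.
Proof.
rewrite /weight big_seq_cond; apply: (big_ind (fun w => 1 <= w)%N).
- exact: step_gt0.
- by move=> w w' w1 w'1; rewrite leq_min w1.
- by move=> w; rewrite mem_index_iota => /andP[/andP[]].
Qed.

Lemma weight_leq (j : 'I_n) : (weight M j <= r)%N.
Proof.
rewrite /weight; elim: (index_iota _ _) => [|w s IH]; first by rewrite big_nil.
by rewrite big_cons; case: ifP => // _; rewrite geq_min IH orbT.
Qed.

Lemma weight_leq_rk (j : 'I_n) w : (1 <= w <= r)%N -> (j < rk M w)%N ->
  (weight M j <= w)%N.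
Proof.
move=> wr jw; rewrite /weight.
have : w \in index_iota 1 r.+1 by rewrite mem_index_iota ltnS.
elim: (index_iota _ _) => // v s IH; rewrite inE big_cons => /orP[/eqP <-|ws].
  by rewrite jw geq_min leqnn.
by case: ifP => _; rewrite ?geq_min IH ?orbT.
Qed.

Lemma frame_tangent j p : U p -> tangent_space p (X j p).
Proof. by have [_ _ /(_ j)[vX _]] := hX => /vX[]. Qed.

Lemma frame_basis p : U p -> basis_of (tangent_space p) (fun j => X j p).
Proof. by have [_ + _] := hX; apply. Qed.

(* Expand a basis of H_w at p in the frame: as the first rk H_w frame vectors
   lie in H_w, the matrix of the expansion has an invertible left block, and
   therefore a zero right block. *)
Lemma frame_filt p w (u : 'rV[R]_n) : U p -> (1 <= w <= r)%N ->
  @filt _ _ _ M w p (\sum_k u 0 k *: X k p) ->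
  forall k, (w < weight M k)%N -> u 0 k = 0.
Proof.
move=> Up wr; have /andP[w1 wler] := wr.
have [V [Y [_ Vp _ /(_ p Vp)[_ fE]]]] := filt_subbundle wr p.
have [Xfree XE] := frame_basis Up.
set d := rk M w in Y fE.
rewrite fE => -[s _ sE] k wk.
(* The index [k] lies in the right block, because indices below the rank [d] have weight at most
   [w]. *)
have dk : (d <= k)%N by rewrite leqNgt; apply: contraL wk => /(weight_leq_rk wr); rewrite leqNgt.
have dn : (d <= n)%N by rewrite (leq_trans dk) // ltnW.
have /choice[A AE] i : exists v : 'rV[R]_n, Y i p = \sum_k v 0 k *: X k p.
  have : @filt _ _ _ M w p (Y i p).
    rewrite fE; exists (delta_mx 0 i) => //.
    rewrite (bigD1 i) //= mxE !eqxx scale1r big1 ?addr0 // => j /negPf ji.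
    by rewrite mxE ji andbF scale0r.
  move=> /(filt_leq w1 wler (leqnn r)); rewrite filt_full XE => -[v _ vE].
  by exists v.
have expand (v : 'rV[R]_d) : \sum_i v 0 i *: Y i p =
    \sum_k (\sum_i v 0 i * A i 0 k) *: X k p.
  under eq_bigr => i _ do rewrite AE scaler_sumr.
  rewrite exchange_big; apply: eq_bigr => l _; rewrite scaler_suml.
  by apply: eq_bigr => i _; rewrite scalerA.
have coordsE (v v' : 'rV[R]_n) :
    \sum_k v 0 k *: X k p = \sum_k v' 0 k *: X k p -> v = v'.
  move=> /eqP; rewrite -subr_eq0 -sumrB => /eqP vv'.
  apply/eqP; rewrite -subr_eq0; apply/eqP/Xfree; rewrite -[RHS]vv'.
  by apply: eq_bigr => l _; rewrite !mxE scalerBl.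
(* The rows of [C] expand the first [d] frame vectors in the basis [Y]; substituting the expansion
   [A] of [Y] shows that [C] inverts the left block of [A] and annihilates the right one. *)
have /choice[C CE] (i : 'I_d) : exists v : 'rV[R]_d,
    X (widen_ord dn i) p = \sum_i v 0 i *: Y i p.
  set j := widen_ord dn i.
  have : @filt _ _ _ M w p (X j p).
    have [_ _ /(_ j)[_ /(_ p Up)]] := hX.
    apply: filt_leq => //; first exact: weight_gt0.
    exact: (@weight_leq_rk j w wr (ltn_ord i)).
  by rewrite fE => -[v _ vE]; exists v.
have CA (i : 'I_d) (l : 'I_n) :
    \sum_j C i 0 j * A j 0 l = (widen_ord dn i == l)%:R.
  have := CE i; rewrite expand.
  pose D := delta_mx 0 (widen_ord dn i) : 'rV[R]_n.
  have -> : X (widen_ord dn i) p = \sum_l D 0 l *: X l p.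
    rewrite (bigD1 (widen_ord dn i)) //= mxE !eqxx scale1r big1 ?addr0 //.
    by move=> j /negPf ji; rewrite mxE ji andbF scale0r.
  pose E := \row_l \sum_j C i 0 j * A j 0 l.
  have -> : \sum_k (\sum_j C i 0 j * A j 0 k) *: X k p = \sum_k E 0 k *: X k p.
    by apply: eq_bigr => j _; rewrite mxE.
  by move=> /coordsE/rowP/(_ l); rewrite !mxE eqxx eq_sym /= => ->.
pose Cm := \matrix_(i, j) C i 0 j.
have Cu : Cm \in unitmx.
  suff : Cm *m (\matrix_(j, l) A j 0 (widen_ord dn l)) = 1%:M.
    by move=> /mulmx1_unit[].
  apply/matrixP => i l; rewrite !mxE -[RHS](CA i (widen_ord dn l)).
  by apply: eq_bigr => j _; rewrite !mxE.
have : Cm *m (\col_j A j 0 k) = 0.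
  apply/colP => i; rewrite !mxE (_ : \sum_j _ = \sum_j C i 0 j * A j 0 k).
    rewrite CA; case: eqP => // ik.
    by move: dk; rewrite -ik leqNgt /= ltn_ord.
  by apply: eq_bigr => j _; rewrite !mxE.
move=> /(congr1 (mulmx (invmx Cm))); rewrite mulKmx // mulmx0 => A0.
move: sE; rewrite expand.
have -> : \sum_k (\sum_i s 0 i * A i 0 k) *: X k p =
    \sum_k (\row_k \sum_i s 0 i * A i 0 k) 0 k *: X k p.
  by apply: eq_bigr => j _; rewrite mxE.
move=> /coordsE <-; rewrite mxE big1 // => i _.
by have /colP/(_ i) := A0; rewrite !mxE => ->; rewrite mulr0.
Qed.

(** A row vector killed by the matrix gives a combination of the frame whose coordinates all vanish;
    it is the zero vector, and the frame is free. *)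
Lemma frame_matrix_unit p (x : chart R M n) : U p -> atlas x -> cdom x p ->
  frame_matrix X p x \in unitmx.
Proof.
move=> Up ax xp; rewrite -row_free_unit; apply: inj_row_free => u uB.
have [Xfree XE] := frame_basis Up; apply: Xfree.
have tv : tangent_space p (\sum_k u 0 k *: X k p) by rewrite XE; exists u.
rewrite (tangent_coordE tv ax xp) big1 // => l _.
have /rowP/(_ l) := uB; rewrite !mxE => e.
rewrite fct_sumE (_ : \sum_(i < n) _ = 0) ?scale0r // -[RHS]e.
by apply: eq_bigr => k _; rewrite mxE.
Qed.

(** Multiplying the coordinates of the bracket by the inverse frame matrix gives its coefficients in
    the frame, which are smooth by Cramer's rule; those of weight above [w_i + w_j] vanish by
    [frame_filt]. *)
Lemma bracket_expansion a i j : U a -> (weight M i + weight M j <= r)%N ->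
  exists L : 'I_n -> M -> R,
    [/\ forall k, smooth_fun_at (L k) a,
        forall k, (weight M i + weight M j < weight M k)%N -> L k = fun=> 0 &
        \forall p \near a, bracket (X i) (X j) p = \sum_k L k p *: X k p].
Proof.
move=> Ua ijr; have [oU _ sX] := hX.
have near_U : \forall p \near a, U p by apply: open_nbhs_nbhs.
have [vB fB] := filt_bracket oU (weight_gt0 i) (weight_gt0 j) ijr (sX i) (sX j).
have [x ax xa] := atlas_cover a.
pose V p := \row_l bracket (X i) (X j) p (coord x l).
pose u p := V p *m invmx (frame_matrix X p x).
(* The heavy coefficients are set to 0 outright, so that they vanish as functions and not only near
   [a], where [u] has its meaning. *)
pose L k p := if (weight M i + weight M j < weight M k)%N then 0 else u p 0 k.
exists L; split.
- move=> k; rewrite /L; case: ltnP => _; first exact: smooth_fun_cst.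
  rewrite (_ : (fun p => _) = fun p =>
      \sum_l V p 0 l * invmx (frame_matrix X p x) l k); last first.
    by apply/funext => p; rewrite /u mxE.
  apply: smooth_fun_sum => l _; apply: smooth_funM.
    rewrite (_ : (fun p => _) = apply_field (bracket (X i) (X j)) (coord x l)).
      by have [_] := vB a Ua; apply; apply: smooth_fun_coord.
    by apply/funext => p; rewrite mxE.
  apply: (@smooth_fun_invmx _ _ _ _ (fun p => frame_matrix X p x)).
    move=> k' l'; rewrite (_ : (fun p => _) = apply_field (X k') (coord x l')).
      have [vX _] := sX k'.
      by have [_] := vX a Ua; apply; apply: smooth_fun_coord.
    by apply/funext => p; rewrite mxE.
  move: near_U (near_cdom ax xa); apply: filterS2 => p Up xp.
  exact: frame_matrix_unit.
- by move=> k ijk; apply/funext => p; rewrite /L ijk.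
- move: near_U (near_cdom ax xa); apply: filterS2 => p Up xp.
  have [tB _] := vB p Up.
  have [_ XE] := frame_basis Up; have := tB; rewrite XE => -[v _ vE].
  have uv : u p = v.
    apply: (canLR (mulmxK (frame_matrix_unit Up ax xp))).
    apply/rowP => l; rewrite !mxE -vE fct_sumE.
    by apply: eq_bigr => k _; rewrite mxE.
  rewrite -vE; apply: eq_bigr => k _; congr (_ *: _).
  rewrite /L uv; case: ltnP => // ijk.
  apply: (frame_filt Up) ijk; first by rewrite ijr addn_gt0 weight_gt0.
  by rewrite vE; apply: fB.
Qed.

End Frame.

(** * Privileged coordinates *)

Lemma perm_eq_multi_word n m (alpha beta : {ffun 'I_n -> 'I_m}) :
  perm_eq (multi_word alpha) (multi_word beta) = (alpha == beta).
Proof.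
apply/idP/eqP => [/permP ab|-> //]; apply/ffunP => i; apply: val_inj.
by rewrite /= -!count_multi_word ab.
Qed.

(** As [phi] is a global diffeomorphism, the domain of [x] can be kept; maximality of the atlas
    admits the new chart. *)
Lemma chart_diffeomorphism (R : realType) n (M : manifold R n)
    (x : chart R M n) phi :
  atlas x -> diffeomorphism phi ->
  exists y, [/\ atlas y, cdom y = cdom x &
    forall p, cmap y p = phi (cmap x p)].
Proof.
move=> ax [h [phiK hK sphi sh]].
have [ox oimx xK cx cix] := atlas_chart ax.
exists (Chart (cdom x) (phi \o cmap x) (cinv x \o h)); split=> //.
apply: atlas_maximal.
  split=> //=.
  - have -> : (phi \o cmap x) @` cdom x = h @^-1` (cmap x @` cdom x).
      apply/seteqP; split=> [_ [p xp <-]|z [p xp pz]] /=.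
        by exists p => //=; rewrite phiK.
      by exists p => //=; rewrite pz hK.
    apply: open_comp => // z _; exact: smooth_map_at_continuous.
  - by move=> p xp; rewrite phiK xK.
  - move=> p xp; apply: continuous_comp; first exact: cx.
    exact: smooth_map_at_continuous.
  - move=> p xp; apply: continuous_comp; first exact: smooth_map_at_continuous.
    by rewrite /= phiK; apply: cix.
move=> d ad p /= xp dp; have [sxd sdx] := atlas_compatible ax ad xp dp; split.
  apply: (@smooth_map_at_comp _ _ h (cmap d \o cinv x)) => //.
  by rewrite phiK.
exact: (@smooth_map_at_comp _ _ (cmap x \o cinv d) phi).
Qed.

Section Privileged.
Context {R : realType} {n r : nat} {M : carnot_manifold R n r} (U : set M)
  (X : 'I_n -> field M) (a : M).
Hypotheses (hX : h_frame U X) (Ua : U a).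
Implicit Types (f g : M -> R) (I J : seq 'I_n).

Let oU : open U. Proof. by have [] := hX. Qed.
Let vX j : vector_field U (X j). Proof. by have [_ _ /(_ j)[]] := hX. Qed.

Lemma word_swap f N m I1 i j I2 : smooth_fun_at f a -> (N <= r)%N ->
  (forall I, (size I <= m)%N -> (word_weight M I < N)%N -> apply_word X I f a = 0) ->
  (size (I1 ++ i :: j :: I2) <= m.+1)%N ->
  (word_weight M (I1 ++ i :: j :: I2) < N)%N ->
  apply_word X (I1 ++ i :: j :: I2) f a = apply_word X (I1 ++ j :: i :: I2) f a.
Proof.
move=> sf Nr IH; rewrite size_cat word_weight_cat !word_weight_cons /= => sI wI.
rewrite !word_cat /=; set g := apply_word X I2 f.
have sg : smooth_fun_at g a by apply: (smooth_word vX Ua).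
(* This is where [N <= r] enters: the pair [i], [j] weighs less than [N], so the bracket condition
   applies. *)
have ijr : (weight M i + weight M j <= r)%N by lia.
have [L [sL L0 LE]] := bracket_expansion hX Ua ijr.
have sXg k : smooth_fun_at (apply_field (X k) g) a.
  exact: (smooth_apply_field vX Ua).
have sLX k : smooth_fun_at (L k \* apply_field (X k) g) a by apply: smooth_funM.
rewrite (@word_eq _ _ _ _ U X a oU vX Ua I1 _
  (apply_field (X j) (apply_field (X i) g) \+
   fun p => \sum_k (L k \* apply_field (X k) g) p)); last first.
  move: LE (smooth_fun_near sg); apply: filterS2 => p LE sgp /=.
  have := congr1 (fun v => v g) LE; rewrite /bracket asboolT // fct_sumE /=.
  move=> /eqP; rewrite subr_eq addrC => /eqP; exact.
rewrite (wordD oU vX Ua); first last.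
- by apply: smooth_fun_sum.
- exact: (smooth_apply_field vX Ua).
rewrite (word_sum oU vX Ua) // big1 ?addr0 // => k _.
have [kij|kij] := leqP (weight M k) (weight M i + weight M j); last first.
  rewrite L0 // (_ : _ \* _ = fun=> 0); last first.
    by apply/funext => p; rewrite /= mul0r.
  by rewrite (word_cst oU vX Ua); case: (I1).
(* Letters of [I1] may differentiate [L k], so the words left for [f] are [J ++ k :: I2] with [J] a
   subword of [I1]: the pair [i], [j] has become the single letter [k], of no larger weight. *)
apply: (word_mul_eq0 oU vX Ua) => // J JI.
have -> : apply_word X J (apply_field (X k) g) a = apply_word X (J ++ k :: I2) f a.
  by rewrite word_cat.
have sJ := size_subseq JI; have wJ := word_weight_subseq M JI.
apply: IH.
  by rewrite size_cat (leq_trans (leq_add sJ (leqnn _))) // -ltnS -addnS.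
by rewrite word_weight_cat word_weight_cons; lia.
Qed.

(** The induction is on the length and not on the weight: when [w_k = w_i + w_j], an exchange may
    leave a word of the same weight, but always a shorter one. *)
Lemma order_ge_sorted f N : smooth_fun_at f a -> (N <= r)%N ->
  (forall I, sorted (@ord_leq n) I -> (word_weight M I < N)%N ->
     apply_word X I f a = 0) ->
  order_ge X f N a.
Proof.
move=> sf Nr f0 I; have [m] := ubnP (size I); elim: m I => // m IH I sI wI.
have pI : perm_eq I (sort (@ord_leq n) I) by rewrite perm_sym perm_sort.
have e := @perm_eq_swap_invariant _ _ (fun I => apply_word X I f a)
  (sort (@ord_leq n) I).
rewrite e //.
  apply: f0; last by rewrite -(word_weight_perm M pI).
  by apply: sort_sorted => i j; apply: leq_total.
move=> I1 i j I2 p.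
have pI' : perm_eq (I1 ++ i :: j :: I2) I by rewrite (permPl p) perm_sym.
case: m IH sI => [|m] IH sI.
  by move: (perm_size pI') sI; rewrite size_cat /=; lia.
apply: (@word_swap f N m) => //; last by rewrite (word_weight_perm M pI').
by rewrite (perm_size pI').
Qed.

(** * Polynomial corrections of linearly adapted coordinates *)

Section Coordinates.
Context (y : 'I_n -> M -> R).
Hypotheses (sy : forall k, smooth_fun_at (y k) a) (y0 : forall k, y k a = 0).

Definition low_weight k (alpha : {ffun 'I_n -> 'I_(weight M k)}) :=
  ((\sum_i weight M i * alpha i < weight M k) && (2 <= \sum_i alpha i))%N.

Definition corrected k (c : {ffun 'I_n -> 'I_(weight M k)} -> R) : M -> R :=
  fun p => y k p + \sum_(alpha | low_weight alpha) c alpha * \prod_i y i p ^+ alpha i.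

Lemma smooth_corrected k c : smooth_fun_at (@corrected k c) a.
Proof.
apply: smooth_funD => //; apply: smooth_fun_sum => alpha _.
apply: smooth_funM; first exact: smooth_fun_cst.
rewrite (_ : (fun _ => _) = monomial y (multi_word alpha)).
  exact: smooth_monomial.
by apply/funext => p; rewrite -prod_multi_word.
Qed.

Lemma word_corrected k (c : {ffun 'I_n -> 'I_(weight M k)} -> R) I :
  apply_word X I (corrected c) a = apply_word X I (y k) a +
    \sum_(alpha | low_weight alpha)
      apply_word X I (monomial y (multi_word alpha)) a * c alpha.
Proof.
have sm (alpha : {ffun 'I_n -> 'I_(weight M k)}) :
    smooth_fun_at (fun p => c alpha * monomial y (multi_word alpha) p) a.
  apply: smooth_funM; first exact: smooth_fun_cst.
  exact: smooth_monomial.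
rewrite (_ : corrected c = y k \+ fun p => \sum_(alpha | low_weight alpha)
    c alpha * monomial y (multi_word alpha) p); last first.
  apply/funext => p; rewrite /corrected; congr (_ + _).
  by apply: eq_bigr => alpha _; rewrite -prod_multi_word.
rewrite (wordD oU vX Ua) //; last exact: smooth_fun_sum.
rewrite (word_sum oU vX Ua) //; congr (_ + _); apply: eq_bigr => alpha _.
rewrite mulrC (wordZ oU vX Ua) //; exact: smooth_monomial.
Qed.

Lemma word_monomial_small k (alpha : {ffun 'I_n -> 'I_(weight M k)}) I :
  (size I < \sum_i alpha i)%N ->
  apply_word X I (monomial y (multi_word alpha)) a = 0.
Proof. by rewrite -size_multi_word; apply: (vanishing_monomial oU vX Ua). Qed.

(** The corrections vanish to second order at [a], so they change neither values nor first
    derivatives there. *)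
Lemma word1_corrected k (c : {ffun 'I_n -> 'I_(weight M k)} -> R) I :
  (size I <= 1)%N ->
  apply_word X I (corrected c) a = apply_word X I (y k) a.
Proof.
move=> I1; rewrite word_corrected big1 ?addr0 // => alpha /andP[_ a2].
by rewrite word_monomial_small ?mul0r // (leq_ltn_trans I1).
Qed.

Hypothesis dy : forall j k, X j a (y k) = (j == k)%:R.

Lemma word_monomial_triangular k (alpha beta : {ffun 'I_n -> 'I_(weight M k)}) :
  (size (multi_word beta) <= size (multi_word alpha))%N ->
  (apply_word X (multi_word beta) (monomial y (multi_word alpha)) a != 0) =
  (alpha == beta).
Proof.
rewrite leq_eqVlt => /orP[/eqP s|s].
  have [_ ->] := word_monomial oU vX Ua sy y0 dy s.
  by rewrite perm_eq_multi_word eq_sym.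
rewrite (vanishing_monomial oU vX Ua) // eqxx; apply/esym/negbTE.
by apply: contraTneq s => ->; rewrite ltnn.
Qed.

(** The multi-indices of [low_weight] index both the unknown coefficients and the conditions imposed
    by the [X^beta], which makes the system square. *)
Lemma corrected_exists k :
  exists c, order_ge X (@corrected k c) (weight M k) a.
Proof.
have [c cP] := @triangular_solution _ _ (@low_weight k)
  (fun alpha => size (multi_word alpha))
  (fun beta alpha => apply_word X (multi_word beta) (monomial y (multi_word alpha)) a)
  (fun _ _ _ _ => @word_monomial_triangular _ _ _)
  (fun beta => - apply_word X (multi_word beta) (y k) a).
exists c; apply: order_ge_sorted; [exact: smooth_corrected|exact: weight_leq|].
(* Words of length at most 1 lie outside the system: the empty word gives [y k a = 0], and a letter
   lighter than [k] differs from [k], so it kills [y k] at [a]. *)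
move=> I sI wI; have [I1|I2] := leqP (size I) 1.
  rewrite word1_corrected //; case: I I1 wI {sI} => [|i [|//]] _ wI /=.
    exact: y0.
  rewrite /apply_field dy; case: eqP => // ik.
  by move: wI; rewrite word_weight_cons ik -ltn_subRL subnn ltn0.
(* Each letter weighs at least 1, so its multiplicity in [I] is below [weight M k], the bound on the
   entries of a multi-index. *)
have [] := @sorted_multi_word n (weight M k) I sI.
  move=> i; apply: leq_ltn_trans wI.
  rewrite -sum1_count /word_weight big_mkcond; apply: leq_sum => j _.
  by case: ifP => // _; apply: weight_gt0.
move=> alpha Ialpha; rewrite word_corrected Ialpha cP ?subrr //.
apply/andP; split; last by rewrite -size_multi_word -Ialpha.
by rewrite -sum_multi_word -Ialpha.
Qed.

Lemma corrected_unique k (c c' : {ffun 'I_n -> 'I_(weight M k)} -> R) :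
  order_ge X (corrected c) (weight M k) a ->
  order_ge X (corrected c') (weight M k) a ->
  forall alpha, low_weight alpha -> c alpha = c' alpha.
Proof.
move=> cP c'P; apply: (@triangular_unique _ _ (@low_weight k)
  (fun alpha => size (multi_word alpha))
  (fun beta alpha => apply_word X (multi_word beta) (monomial y (multi_word alpha)) a)
  (fun _ _ _ _ => @word_monomial_triangular _ _ _)).
move=> beta /andP[wb _]; have wb' : (word_weight M (multi_word beta) < weight M k)%N.
  by rewrite /word_weight sum_multi_word.
apply: (@addrI _ (apply_word X (multi_word beta) (y k) a)).
by rewrite -!word_corrected cP ?c'P.
Qed.

End Coordinates.
End Privileged.

Lemma psi_hat_diffeomorphism (R : realType) n r (M : carnot_manifold R n r)
    (psi : 'rV[R]_n -> 'rV[R]_n) : psi_hat_form M psi -> diffeomorphism psi.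
Proof.
move=> [c psiE]; apply: triangular_diffeomorphism psiE.
  move=> k z; apply: smooth_at_sum => alpha _; apply: smooth_atM.
    exact: smooth_at_cst.
  by apply: smooth_at_prod => i _; apply/smooth_atX/smooth_at_coord.
move=> k z z' zz'; apply: eq_bigr => alpha /andP[ak _]; congr (_ * _).
(* A variable that occurs in [x^alpha] has weight at most [<alpha> < w_k], so the map is triangular
   with respect to the weights. *)
apply: eq_bigr => i _; have [->|ai] := eqVneq (alpha i : nat) 0%N.
  by rewrite !expr0.
rewrite zz' //; apply: leq_ltn_trans ak.
by rewrite (bigD1 i) //= (leq_trans _ (leq_addr _ _)) // leq_pmulr // lt0n.
Qed.

(** * Existence and uniqueness of the psi-coordinates *)

Section PsiCoordinates.
Context {R : realType} {n r : nat} {M : carnot_manifold R n r} (U : set M)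
  (X : 'I_n -> field M) (a : M) (x : chart R M n).
Hypotheses (hX : h_frame U X) (Ua : U a) (ax : atlas x) (xa : cdom x a).

Let oU : open U. Proof. by have [] := hX. Qed.
Let vX j : vector_field U (X j). Proof. by have [_ _ /(_ j)[]] := hX. Qed.

Definition affine_coord (A : 'M[R]_n) k : M -> R :=
  fun p => ((cmap x p - cmap x a) *m A) 0 k.

Lemma smooth_affine_coord A k : smooth_fun_at (affine_coord A k) a.
Proof.
apply: (@smooth_fun_comp _ _ _ (fun z => ((z - cmap x a) *m A) 0 k)) => //.
apply: (@smooth_map_at_affine _ _ (fun z => (z - cmap x a) *m A)).
by exists A, (- (cmap x a *m A)) => z; rewrite mulmxBl.
Qed.

Lemma affine_coord0 A k : affine_coord A k a = 0.
Proof. by rewrite /affine_coord subrr mul0mx mxE. Qed.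

Lemma frame_affine_coord A j k :
  X j a (affine_coord A k) = (frame_matrix X a x *m A) j k.
Proof.
have tX := frame_tangent hX j Ua.
pose F l := (coord x l \* (fun=> A l k)) \+ (fun=> - cmap x a 0 l * A l k).
have sF l : smooth_fun_at (coord x l \* (fun=> A l k)) a.
  apply: smooth_funM; [exact: smooth_fun_coord|exact: smooth_fun_cst].
have -> : affine_coord A k = fun p => \sum_l F l p.
  apply/funext => p; rewrite /affine_coord mxE; apply: eq_bigr => l _.
  by rewrite !mxE /F /= mulrDl.
rewrite (tangent_sum _ tX) => [|l]; last first.
  by apply: smooth_funD => //; apply: smooth_fun_cst.
rewrite mxE; apply: eq_bigr => l _; rewrite mxE.
rewrite (tangentD tX) //; last exact: smooth_fun_cst.
have sx := smooth_fun_coord l ax xa.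
rewrite (tangentM tX sx (@smooth_fun_cst _ _ M (A l k) a)).
by rewrite !(tangent_cst _ tX) mulr0 !addr0.
Qed.

Lemma frame_T_coord j k :
  X j a (affine_coord (invmx (frame_matrix X a x)) k) = (j == k)%:R.
Proof.
by rewrite frame_affine_coord mulmxV ?mxE //; apply: (frame_matrix_unit hX).
Qed.

Lemma affine_map_centered (T : 'rV[R]_n -> 'rV[R]_n) :
  affine_map T -> T (cmap x a) = 0 ->
  exists A, forall z, T z = (z - cmap x a) *m A.
Proof.
move=> [A [b TE]] T0; exists A => z.
by rewrite mulmxBl -[RHS]addr0 -T0 !TE; apply/rowP => i; rewrite !mxE; ring.
Qed.

Definition psi_hat_coefs (psi : 'rV[R]_n -> 'rV[R]_n)
    (c : forall k : 'I_n, {ffun 'I_n -> 'I_(weight M k)} -> R) :=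
  forall (z : 'rV[R]_n) (k : 'I_n), psi z 0 k = z 0 k +
    \sum_(alpha | low_weight alpha) c k alpha * \prod_i z 0 i ^+ alpha i.

Lemma psi_hat_coordE psi c A (y : chart R M n) k :
  psi_hat_coefs psi c -> atlas y -> cdom y a ->
  (forall p, cdom y p -> cmap y p = psi ((cmap x p - cmap x a) *m A)) ->
  \forall p \near a, coord y k p = corrected (affine_coord A) (c k) p.
Proof.
move=> psiE ay ya yE; move: (near_cdom ay ya); apply: filterS => p yp.
by rewrite /coord yE // psiE.
Qed.

Lemma psi_hat_order psi c A :
  psi_hat_coefs psi c ->
  gives_privileged X a x (psi \o fun z => (z - cmap x a) *m A) ->
  forall k, order_ge X (corrected (affine_coord A) (c k)) (weight M k) a.
Proof.
move=> psiE [y [ay ya _ yE [_ yo]]] k I wI.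
have [/(_ I wI) <- _] := yo k; apply/esym.
exact: (word_eq oU vX Ua I (psi_hat_coordE k psiE ay ya yE)).
Qed.

Lemma privileged_linear_part psi A :
  psi_hat_form M psi ->
  gives_privileged X a x (psi \o fun z => (z - cmap x a) *m A) ->
  A = invmx (frame_matrix X a x).
Proof.
move=> [c psiE] [y [ay ya _ yE [[_ Xy] _]]].
(* Both sides compute [X_j y_k] at [a]: the corrections do not contribute, and [X_j] is the
   coordinate vector of [y] there. *)
have BA : frame_matrix X a x *m A = 1%:M.
  apply/matrixP => j k; rewrite -frame_affine_coord mxE.
  rewrite -(coord_vector_coord j k ay ya) -Xy.
  rewrite (tangent_near (frame_tangent hX j Ua) (psi_hat_coordE k psiE ay ya yE)).
  have := @word1_corrected _ _ _ _ U X a hX Ua _ (smooth_affine_coord A)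
    (affine_coord0 A) k (c k) [:: j] isT.
  by rewrite /apply_word /= /apply_field => ->.
have Bu := frame_matrix_unit hX Ua ax xa.
by rewrite -[LHS](mulKmx Bu) BA mulmx1.
Qed.

Lemma psi_hat_unique psi psi' :
  psi_hat_form M psi -> gives_privileged X a x (psi \o T_map X a x) ->
  psi_hat_form M psi' -> gives_privileged X a x (psi' \o T_map X a x) ->
  psi = psi'.
Proof.
move=> [c psiE] psiP [c' psiE'] psiP'.
apply/funext => z; apply/rowP => k; rewrite psiE psiE'; congr (_ + _).
apply: eq_bigr => alpha qa; congr (_ * _).
apply: (corrected_unique hX Ua (smooth_affine_coord _) (affine_coord0 _)
  frame_T_coord) qa.
  exact: psi_hat_order psiE psiP k.
exact: psi_hat_order psiE' psiP' k.
Qed.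

Lemma psi_hat_exists : exists psi,
  psi_hat_form M psi /\ gives_privileged X a x (psi \o T_map X a x).
Proof.
set A := invmx (frame_matrix X a x).
have cE k := cid (corrected_exists hX Ua (smooth_affine_coord A) (affine_coord0 A)
  frame_T_coord k).
pose c k := projT1 (cE k).
have cP k : order_ge X (corrected (affine_coord A) (c k)) (weight M k) a.
  exact: projT2 (cE k).
pose psi (z : 'rV[R]_n) : 'rV[R]_n := \row_k (z 0 k +
  \sum_(alpha | @low_weight _ _ _ M k alpha) c k alpha * \prod_i z 0 i ^+ alpha i).
have psiE : psi_hat_coefs psi c by move=> z k; rewrite mxE.
have psiF : psi_hat_form M psi by exists c.
have Bu := frame_matrix_unit hX Ua ax xa.
have Td : diffeomorphism (T_map X a x).
  exists (fun z => z *m frame_matrix X a x + cmap x a); split.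
  - by move=> z; rewrite /T_map mulmxKV // subrK.
  - by move=> z; rewrite /T_map addrK mulmxK.
  - move=> z; apply: smooth_map_at_affine.
    by exists A, (- (cmap x a *m A)) => z'; rewrite /T_map mulmxBl.
  - move=> z; apply: smooth_map_at_affine.
    by exists (frame_matrix X a x), (cmap x a).
have [y [ay yx yE]] := chart_diffeomorphism ax
  (diffeomorphism_comp Td (psi_hat_diffeomorphism psiF)).
have ya : cdom y a by rewrite yx.
have yE' p : cdom y p -> cmap y p = psi ((cmap x p - cmap x a) *m A).
  by move=> _; rewrite yE.
have ynear k := psi_hat_coordE k psiE ay ya yE'.
have Xy j k : X j a (coord y k) = (j == k)%:R.
  rewrite (tangent_near (frame_tangent hX j Ua) (ynear k)).
  have := @word1_corrected _ _ _ _ U X a hX Ua _ (smooth_affine_coord A)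
    (affine_coord0 A) k (c k) [:: j] isT.
  by rewrite /apply_word /= /apply_field => ->; apply: frame_T_coord.
have yw k I : apply_word X I (coord y k) a =
    apply_word X I (corrected (affine_coord A) (c k)) a.
  exact: (word_eq oU vX Ua I (ynear k)).
exists psi; split=> //; exists y; split=> //; first by rewrite yx.
split; first split.
(* That [y] is centered is the case of the empty word, whose weight 0 is below every [w_k]. *)
- apply/rowP => k; rewrite mxE; have := yw k [::]; rewrite /= /coord => ->.
  rewrite -[LHS]/(apply_word X [::] _ a).
  by apply: cP; rewrite /word_weight big_nil weight_gt0.
- move=> j; rewrite (tangent_coordE (frame_tangent hX j Ua) ay ya).
  rewrite (bigD1 j) //= Xy eqxx scale1r big1 ?addr0 // => l lj.
  by rewrite Xy eq_sym (negPf lj) scale0r.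
- move=> k; split; first by move=> I wI; rewrite yw cP.
  (* The order is exactly [w_k] because [X_k y_k] is 1 at [a]. *)
  exists [:: k]; first by rewrite /word_weight big_seq1.
  by rewrite /= /apply_field Xy eqxx oner_neq0.
Qed.

End PsiCoordinates.

Theorem proposition3p24 (R : realType) (n r : nat) (M : carnot_manifold R n r)
    (U : set M) (X : 'I_n -> field M) (a : M) (x : chart R M n) :
  h_frame U X -> U a -> atlas x -> cdom x a ->
  (gives_privileged X a x (psi_map X a x) /\
   affine_psi_hat_form a x (psi_map X a x)) /\
  (forall psi : 'rV[R]_n -> 'rV[R]_n,
     gives_privileged X a x psi -> affine_psi_hat_form a x psi ->
     psi = psi_map X a x).
Proof.
move=> hX Ua ax xa.
have [psiF psiP] : psi_hat_form M (psi_hat_map X a x) /\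
    gives_privileged X a x (psi_hat_map X a x \o T_map X a x).
  (* Existence makes [get] return a map with the two properties rather than its default value. *)
  exact: (getPex (psi_hat_exists hX Ua ax xa)).
split; first split=> //.
  exists (T_map X a x), (psi_hat_map X a x); split=> //.
  - exists (invmx (frame_matrix X a x)), (- (cmap x a *m invmx (frame_matrix X a x))).
    by move=> z; rewrite /T_map mulmxBl.
  - by rewrite /T_map subrr mul0mx.
  - exact: psi_hat_diffeomorphism psiF.
move=> psi psiP' [T [phi [aT T0 phiF _ psiE]]].
have {psiP'}phiP : gives_privileged X a x (phi \o T) by rewrite -psiE.
rewrite {}psiE.
have [A TE] := affine_map_centered aT T0.
have {}TE : T = fun z => (z - cmap x a) *m A by apply/funext.
(* The affine part is identified before the polynomial part, because [psi_hat_unique] compares two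
   maps over the same [T_map]. *)
have AE : A = invmx (frame_matrix X a x).
  by move: phiP; rewrite TE; apply: (privileged_linear_part hX Ua ax xa phiF).
have {}TE : T = T_map X a x by rewrite TE AE.
rewrite TE in phiP *; congr (_ \o _).
exact: (psi_hat_unique hX Ua ax xa phiF phiP psiF psiP).
Qed.
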